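(* Let $n,m$ be coprime positive integers, let $(\mathbb X,H)$ be one of $(X,F)$, $(\mathtt W,G)$, $(\mathring{\mathcal B},B)$, and let $\mathcal X=[\mathbb X\times\mathbb Z]$. Suppose that $H$ satisfies the following two conditions for all $\beta\in\Delta_1^+$: (i) if $\lambda\in\mathbb X_\beta\cap\mathbb X(\mathrm{r.full})$ and $\lambda^{-_r}\in\mathbb X_{\nu\beta}$, then $H(\rho_\beta)(\lambda)\in\mathbb X(\mathrm{r.full})$ and $(H(\rho_\beta)(\lambda))^{-_r}=H(\rho_{\nu\beta})(\lambda^{-_r})$; (ii) if $\lambda\in\mathbb X_\beta\cap\mathbb X(\mathrm{c.full})$ and $\lambda^{-_c}\in\mathbb X_{\eta\beta}$, then $H(\rho_\beta)(\lambda)\in\mathbb X(\mathrm{c.full})$ and $(H(\rho_\beta)(\lambda))^{-_c}=H(\rho_{\eta\beta})(\lambda^{-_c})$. Then: (a) There is a functor $\mathbb H:\mathfrak T_{iso}\to\mathcal S(\mathcal X)$ given by $\mathbb H(\alpha)=\mathcal X_\alpha$ and $$\mathbb H(\rho_\alpha)[\lambda,in+jm]=[H(\rho_{\eta^i\nu^j\alpha})(\lambda),in+jm]\quad\text{for }\lambda\in\mathbb X_{\eta^i\nu^j\alpha},\ i,j\in\mathbb Z.$$ (b) The map $\mathbb X\to\mathcal X$, $\lambda\mapsto[\lambda,0]$, is injective and compatible with the $\mathfrak T_{iso}$-action: if $\lambda\in\mathbb X_\alpha$, then $\mathbb H(\rho_\alpha)[\lambda,0]=[H(\rho_\alpha)(\lambda),0]$.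 Thus the action of $\mathfrak T_{iso}$ on $\mathbb X$ extends to an action on $[\mathbb X\times\mathbb Z]$.
   Context: **Young diagrams.** $\mathbf R$ is a rectangle with $n$ rows, indexed from the top down by $\epsilon_1,\dots,\epsilon_n$, and $m$ columns, indexed from left to right by $\delta_1,\dots,\delta_m$. The box in row $\epsilon_i$ and column $\delta_j$ is $\mathfrak B(\epsilon_i-\delta_j)$. $X$ is the set of partitions $\lambda=(\lambda_1\ge\dots\ge\lambda_n)$ with $m\ge\lambda_1$, $\lambda_n\ge0$, identified with Young diagrams in the bottom left corner of $\mathbf R$ ($\lambda_p$ is the number of leftmost boxes of $\lambda$ in row $\epsilon_{n+1-p}$). $\lambda'_j=|\{p:\lambda_p\ge j\}|$. $\Delta_1^+=\{\epsilon_i-\delta_j\}$, $\Delta_{iso}=\Delta_1^+\cup(-\Delta_1^+)$. For $\alpha\in\Delta_1^+$, $X_\alpha$ (resp. $X_{-\alpha}$) is the set of $\lambda\in X$ such that adding a box $\mathfrak B(\alpha)\notin\lambda$ (resp. deleting a box $\mathfrak B(\alpha)\in\lambda$) gives a Young diagram; $t_{\pm\alpha}:X_{\pm\alpha}\to X_{\mp\alpha}$ adds/deletes this box. **Words, shuffles, Borels.** $\mathtt W$ is the set of words with $m$ letters $\mathtt r$ and $n$ letters $\mathtt d$. The bijection $\mathtt w:X\to\mathtt W$ sends $\lambda$ to the sequence of right ($\mathtt r$) and down ($\mathtt d$) unit steps of the upper border of $\lambda$ from the top left to the bottom right corner of $\mathbf R$. A shuffle is a sequence $\sigma=(\sigma(1),\dots,\sigma(m+n))$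 that orders $\{1,\dots,n\}\cup\{1',\dots,m'\}$ so that $1,\dots,n$ and $1',\dots,m'$ are subsequences; $\mathbf{sh}(w)$ is the shuffle obtained from $w$ by replacing, from left to right, letters $\mathtt d$ by $1,\dots,n$ and letters $\mathtt r$ by $1',\dots,m'$. Put $\epsilon_{j'}=\delta_j$. $\mathring{\mathcal B}$ is the set of Borel subalgebras of $\mathfrak{gl}(n|m)$ whose even part consists of the upper triangular even matrices; it is in bijection with shuffles, $\mathring{\mathfrak b}(\sigma)$ having simple roots $\mathring\Pi(\sigma)=\{\epsilon_{\sigma(p)}-\epsilon_{\sigma(p+1)}:1\le p\le m+n-1\}$. These give bijections $X\leftrightarrow\mathtt W\leftrightarrow\mathring{\mathcal B}$. For $\alpha\in\Delta_{iso}$, $\mathtt W(\alpha)=\{w:\alpha\in\mathring\Pi(\mathbf{sh}(w))\}$ and $\mathring{\mathcal B}(\alpha)$ is the set of elements of $\mathring{\mathcal B}$ with $\alpha$ as a simple root. For $\alpha=\epsilon_i-\delta_j$, $p_\alpha:\mathtt W(\alpha)\to\mathtt W(-\alpha)$ replaces the consecutive letters $\mathtt d\mathtt r$ corresponding to the consecutive entries $i,j'$ of $\mathbf{sh}(w)$ by $\mathtt r\mathtt d$, and $p_{-\alpha}=p_\alpha^{-1}$. $r_\alpha:\mathring{\mathcal B}(\alpha)\to\mathring{\mathcal B}(-\alpha)$ is the odd reflection (replace simple root $\alpha$ by $-\alpha$, a simple root $\beta$ with $\alpha+\beta$ a root by $\alpha+\beta$, fix the other simple roots). **Groupoid actions.**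 $\mathfrak T_{iso}$ is the groupoid with base $\Delta_{iso}$ and non-identity morphisms $\rho_\alpha:\alpha\to-\alpha$. For a set $Y$, $\mathcal S(Y)$ is the groupoid with objects the subsets of $Y$ and morphisms the bijections between subsets. The functors $F,G,B$ from $\mathfrak T_{iso}$ to $\mathcal S(X),\mathcal S(\mathtt W),\mathcal S(\mathring{\mathcal B})$ are $F(\alpha)=X_\alpha$, $F(\rho_\alpha)=t_\alpha$; $G(\alpha)=\mathtt W(\alpha)$, $G(\rho_\alpha)=p_\alpha$; $B(\alpha)=\mathring{\mathcal B}(\alpha)$, $B(\rho_\alpha)=r_\alpha$. Write $\mathbb X_\alpha=H(\alpha)$. **Equivalence relation.** $X(\mathrm{r.full})=\{\lambda_1=m\}$, $X(\mathrm{c.full})=\{\lambda'_1=n\}$; $\lambda^{-_r}=(\lambda_2,\dots,\lambda_n,0)$ on $X(\mathrm{r.full})$, $\lambda^{-_c}=(\lambda_1-1,\dots,\lambda_n-1)$ on $X(\mathrm{c.full})$. These subsets and maps are transported to $\mathtt W$ and $\mathring{\mathcal B}$ by the bijections. $\sim$ is the smallest equivalence relation on $\mathbb X\times\mathbb Z$ with $(x,k)\sim(x^{-_r},k+m)$ for $x\in\mathbb X(\mathrm{r.full})$ and $(x,k)\sim(x^{-_c},k+n)$ for $x\in\mathbb X(\mathrm{c.full})$; $[\mathbb X\times\mathbb Z]$ is the set of classes $[x,k]$. **Rotation.** $\nu,\eta$ act on roots by $\nu(\epsilon_i)=\epsilon_{i+1}$ (indices mod $n$), $\nu(\delta_j)=\delta_j$,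 $\eta(\delta_{j+1})=\delta_j$ (indices mod $m$), $\eta(\epsilon_i)=\epsilon_i$. Every integer can be written $in+jm$ with $i,j\in\mathbb Z$, and $\eta^i\nu^j$ depends only on $in+jm$. $\mathcal X_\alpha$ is the set of classes containing an element $(x,in+jm)$ with $x\in\mathbb X_{\eta^i\nu^j\alpha}$. *)

(* Defs.v *)
From HB Require Import structures.
From mathcomp Require Import all_boot all_order all_algebra.
From mathcomp Require Import boolp classical_sets.
From mathcomp Require Import zify.
From Stdlib Require Relation_Operators.

Set Implicit Arguments.
Unset Strict Implicit.
Unset Printing Implicit Defensive.

Import Order.TTheory GRing.Theory Num.Theory.

Local Open Scope classical_set_scope.
Local Open Scope ring_scope.

Record groupoid := Groupoid {
  obj :> Type;
  hom : obj -> obj -> Type;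
  idg : forall a, hom a a;
  compg : forall a b c, hom b c -> hom a b -> hom a c;
  invg : forall a b, hom a b -> hom b a;
  compg1 : forall a b (f : hom a b), compg f (idg a) = f;
  comp1g : forall a b (f : hom a b), compg (idg b) f = f;
  compgA : forall a b c d (h : hom c d) (g : hom b c) (f : hom a b),
    compg h (compg g f) = compg (compg h g) f;
  compVg : forall a b (f : hom a b), compg (invg f) f = idg a;
  compgV : forall a b (f : hom a b), compg f (invg f) = idg b }.

Record functor (C D : groupoid) := Functor {
  fobj :> C -> D;
  fmap : forall a b : C, hom a b -> hom (fobj a) (fobj b);
  fmap1 : forall a : C, fmap (idg a) = idg (fobj a);
  fmapM : forall (a b c : C) (g : hom b c) (f : hom a b),
    fmap (compg g f) = compg (fmap g) (fmap f) }.
Arguments fmap {C D} _ {a b} _.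

Section Bijections.
Variable Y : Type.

Record bij (A B : set Y) := Bij {
  fwd :> A -> B;
  bwd : B -> A;
  fwdK : cancel fwd bwd;
  bwdK : cancel bwd fwd }.

Lemma bij_ext (A B : set Y) (f g : bij A B) : fwd f =1 fwd g -> f = g.
Proof.
case: f g => [f f' fK f'K] [g g' gK g'K] /= /funext efg; subst g.
have e : f' = g' by apply: funext => y; rewrite -[y in LHS]g'K fK.
by subst g'; congr Bij; exact: Prop_irrelevance.
Qed.

Definition bij_id (A : set Y) : bij A A :=
  @Bij A A id id (fun=> erefl) (fun=> erefl).

Definition bij_comp (A B C : set Y) (g : bij B C) (f : bij A B) : bij A C :=
  Bij (can_comp (fwdK g) (fwdK f)) (can_comp (bwdK f) (bwdK g)).

Definition bij_inv (A B : set Y) (f : bij A B) : bij B A :=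
  Bij (bwdK f) (fwdK f).

Definition subset_groupoid : groupoid.
Proof.
refine (@Groupoid (set Y) bij bij_id bij_comp bij_inv _ _ _ _ _).
- by move=> A B f; exact: bij_ext.
- by move=> A B f; exact: bij_ext.
- by move=> A B C D h g f; exact: bij_ext.
- by move=> A B f; apply: bij_ext => x /=; rewrite fwdK.
- by move=> A B f; apply: bij_ext => x /=; rewrite bwdK.
Defined.

Definition app (A B : set Y) (f : bij A B) (x : A) : Y := val (f x).

(** [maps f y z]: y lies in the domain of f and f y = z. *)
Definition maps (A B : set Y) (f : bij A B) (y z : Y) : Prop :=
  exists2 x : A, val x = y & app f x = z.

End Bijections.

(** Indices are 0-based: epsilon_(i+1) is the index i : 'I_n and delta_(j+1) is
  the index j : 'I_m. *)

Section Roots.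
Variables n m : nat.

Definition idx := ('I_n + 'I_m)%type.

Definition weight := {ffun idx -> int}.

(** [eps (inl i)] is epsilon_i, and [eps (inr j)] is epsilon_(j') = delta_j. *)
Definition eps (a : idx) : weight := [ffun x => (x == a)%:R].

Definition is_root (x : weight) : Prop :=
  exists a c : idx, a != c /\ x = eps a - eps c.

(** [(false, (i, j))] encodes epsilon_i - delta_j, and [(true, (i, j))] its
  opposite. *)
Definition isoroot := (bool * ('I_n * 'I_m))%type.

Definition src (x : isoroot) : idx := if x.1 then inr x.2.2 else inl x.2.1.
Definition tgt (x : isoroot) : idx := if x.1 then inl x.2.1 else inr x.2.2.
Definition root_of (x : isoroot) : weight := eps (src x) - eps (tgt x).

Definition positive (x : isoroot) : bool := ~~ x.1.
Definition neg (x : isoroot) : isoroot := (~~ x.1, x.2).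

Lemma negK : involutive neg.
Proof. by case=> [[] []]. Qed.

Definition nu_root (x : isoroot) : isoroot := (x.1, (ordS x.2.1, x.2.2)).
Definition eta_root (x : isoroot) : isoroot := (x.1, (x.2.1, ord_pred x.2.2)).

Definition iterz (T : finType) (f : T -> T) (k : int) : T -> T :=
  match k with Posz p => iter p f | Negz p => iter p.+1 (finv f) end.

(** eta^i nu^j *)
Definition etanu (i j : int) (x : isoroot) : isoroot := iterz eta_root i (iterz nu_root j x).

(** A morphism x -> y is the identity (false, y = x) or rho_x (true, y = -x). *)
Definition tiso_hom (x y : isoroot) := {s : bool | y == if s then neg x else x}.

Definition tiso_id (x : isoroot) : tiso_hom x x := exist _ false (eqxx x).

Definition rho (x : isoroot) : tiso_hom x (neg x) := exist _ true (eqxx (neg x)).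

Lemma tiso_comp_subproof x y z (g : tiso_hom y z) (f : tiso_hom x y) :
  z == if val g (+) val f then neg x else x.
Proof.
by case: g f => [[] /= /eqP->] [[] /= /eqP->] /=; rewrite ?negK.
Qed.

Definition tiso_comp x y z (g : tiso_hom y z) (f : tiso_hom x y) :
  tiso_hom x z := exist _ (val g (+) val f) (tiso_comp_subproof g f).

Lemma tiso_inv_subproof x y (f : tiso_hom x y) :
  x == if val f then neg y else y.
Proof. by case: f => [[] /= /eqP->]; rewrite ?negK. Qed.

Definition tiso_inv x y (f : tiso_hom x y) : tiso_hom y x :=
  exist _ (val f) (tiso_inv_subproof f).

Definition Tiso : groupoid.
Proof.
refine (@Groupoid isoroot tiso_hom tiso_id tiso_comp tiso_inv _ _ _ _ _).
- by move=> x y f; apply: val_inj; rewrite /= addbF.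
- by move=> x y f; apply: val_inj.
- by move=> x y z t h g f; apply: val_inj; rewrite /= addbA.
- by move=> x y f; apply: val_inj; rewrite /= addbb.
- by move=> x y f; apply: val_inj; rewrite /= addbb.
Defined.

End Roots.

(** The functor T_iso -> S(Y) with x |-> A x and rho_x |-> t x restricted to
  A x. *)
Section MakeFunctor.
Variables (n m : nat) (Y : Type) (A : isoroot n m -> set Y).
Variable t : isoroot n m -> Y -> Y.
Hypothesis tA : forall x y, A x y -> A (neg x) (t x y).
Hypothesis tK : forall x y, A x y -> t (neg x) (t x y) = y.

Definition flip (s : bool) x y := if s then t x y else y.

Lemma flip_in x x' (f : tiso_hom x x') (y : A x) : flip (val f) x (val y) \in A x'.
Proof.
by case: y f => [y /set_mem Ay] [[] /= /eqP->]; apply: mem_set => //; exact: tA.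
Qed.

Definition flip_fwd x x' (f : tiso_hom x x') (y : A x) : A x' :=
  exist _ (flip (val f) x (val y)) (flip_in f y).

Lemma flip_fwdK x x' (f : tiso_hom x x') :
  cancel (flip_fwd f) (flip_fwd (tiso_inv f)).
Proof.
case=> y yA; apply: val_inj; case: f => [[] /= /eqP e] //=.
by subst x'; rewrite tK //; exact: set_mem.
Qed.

Lemma flip_bwdK x x' (f : tiso_hom x x') :
  cancel (flip_fwd (tiso_inv f)) (flip_fwd f).
Proof.
case=> y yA; apply: val_inj; case: f => [[] /= /eqP e] //=.
have -> : x = neg x' by rewrite e negK.
by rewrite tK //; exact: set_mem.
Qed.

Definition make_functor : functor (Tiso n m) (subset_groupoid Y).
Proof.
refine (@Functor (Tiso n m) (subset_groupoid Y) A
  (fun x x' f => Bij (@flip_fwdK x x' f) (@flip_bwdK x x' f)) _ _).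
- by move=> x; apply: bij_ext => y; apply: val_inj.
- move=> x1 x2 x3 [s2 e2] [s1 e1]; apply: bij_ext => -[y yA]; apply: val_inj => /=.
  move: e2 e1 => /eqP e2 /eqP e1; case: s1 e1 => e1; case: s2 e2 => e2 //=.
    by subst x2; rewrite tK //; exact: set_mem.
  by subst x2.
Defined.

End MakeFunctor.

Section Young.
Variables n m : nat.

Definition is_partition (lam : {ffun 'I_n -> 'I_m.+1}) :=
  [forall p : 'I_n, forall q : 'I_n, (p <= q)%N ==> (lam q <= lam p)%N].

Definition young := {lam | is_partition lam}.

(** [part lam p] is lambda_(p+1); it is 0 for p >= n. *)
Definition part (lam : young) (p : nat) : nat :=
  if insub p is Some q then nat_of_ord (val lam q) else 0%N.

Definition conj_part (lam : young) (j : nat) : nat :=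
  #|[set p : 'I_n | (j <= part lam p)%N]|.

(** Row epsilon_(i+1) of the rectangle holds the part lambda_(n-i). *)
Definition boxes (lam : young) : {set 'I_n * 'I_m} :=
  [set b : 'I_n * 'I_m | (b.2 < part lam (rev_ord b.1))%N]%SET.

Lemma partE lam (p : 'I_n) : part lam p = val lam p.
Proof. by rewrite /part valK. Qed.

Lemma part_le lam p q : (p <= q)%N -> (part lam q <= part lam p)%N.
Proof.
move=> pq; rewrite /part; case: insubP => // q' lt_qn eq_q.
rewrite insubT ?(leq_ltn_trans pq) // => lt_pn.
have /forallP/(_ (Sub p lt_pn))/forallP/(_ q')/implyP := valP lam; apply.
by rewrite eq_q.
Qed.

Lemma part_le_m lam p : (part lam p <= m)%N.
Proof. by rewrite /part; case: insubP => // q _ _; rewrite -ltnS. Qed.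

Lemma boxes_inj : injective boxes.
Proof.
move=> lam mu eb.
have sub x y (p : 'I_n) : boxes x = boxes y -> (part x p <= part y p)%N.
  move=> exy; rewrite leqNgt; apply/negP => lt.
  have ltm : (part y p < m)%N by apply: leq_trans lt (part_le_m _ _).
  have : (rev_ord p, Ordinal ltm) \in boxes x by rewrite inE rev_ordK.
  by rewrite exy inE rev_ordK ltnn.
apply/val_inj/ffunP => p; apply/val_inj; rewrite /= -!partE.
by apply/eqP; rewrite eqn_leq !sub.
Qed.

Definition toggle (x : isoroot n m) (b : {set 'I_n * 'I_m}) : {set 'I_n * 'I_m} :=
  if x.1 then (b :\ x.2)%SET else (x.2 |: b)%SET.

(** [x.1] says whether x is negative, i.e. whether the box has to be present. *)
Definition youngR (x : isoroot n m) : set young :=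
  [set lam | (x.2 \in boxes lam) = x.1 /\
             exists mu, boxes mu = toggle x (boxes lam)].

Definition young_move (x : isoroot n m) (lam : young) : young :=
  odflt lam [pick mu | boxes mu == toggle x (boxes lam)].

Lemma boxes_move x lam :
  youngR x lam -> boxes (young_move x lam) = toggle x (boxes lam).
Proof.
rewrite /young_move => -[_ [mu emu]]; case: pickP => [mu' /eqP //|/(_ mu)].
by rewrite emu eqxx.
Qed.

Lemma toggleK x lam :
  youngR x lam -> toggle (neg x) (toggle x (boxes lam)) = boxes lam.
Proof.
case: x => [[] b] [/= hb _]; rewrite /toggle /=; first by rewrite finset.setD1K ?hb.
by rewrite setU1K // hb.
Qed.

Lemma young_move_in x lam : youngR x lam -> youngR (neg x) (young_move x lam).
Proof.
move=> xl; split; last by exists lam; rewrite boxes_move // toggleK.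
by rewrite boxes_move // /toggle; case: x {xl} => [[] b] /=; rewrite !inE eqxx.
Qed.

Lemma young_moveK x lam :
  youngR x lam -> young_move (neg x) (young_move x lam) = lam.
Proof.
move=> xl; apply: boxes_inj.
by rewrite (boxes_move (young_move_in xl)) (boxes_move xl) toggleK.
Qed.

Definition young_functor := make_functor young_move_in young_moveK.

Definition young_rfull : set young := [set lam | part lam 0 = m].
Definition young_cfull : set young := [set lam | conj_part lam 1 = n].

Lemma young_subproof (f : nat -> nat) :
  (forall p q, (p <= q)%N -> (f q <= f p)%N) ->
  is_partition [ffun p : 'I_n => inord (minn m (f p))].
Proof.
move=> fle; apply/forallP => p; apply/forallP => q; apply/implyP => pq.
by rewrite !ffunE !inordK ?ltnS ?geq_minl // leq_min geq_minl geq_min fle ?orbT.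
Qed.

(** The cut-off at m only keeps the definition total; see [part_young_of]. *)
Definition young_of (f : nat -> nat)
    (fle : forall p q, (p <= q)%N -> (f q <= f p)%N) : young :=
  exist _ [ffun p : 'I_n => inord (minn m (f p))] (young_subproof fle).

Lemma part_young_of f fle p :
  (p < n)%N -> (f p <= m)%N -> part (@young_of f fle) p = f p.
Proof.
move=> pn pm; rewrite /part insubT /= ffunE inordK ?ltnS ?geq_minl //.
exact/minn_idPr.
Qed.

Lemma rdel_le lam p q : (p <= q)%N -> (part lam q.+1 <= part lam p.+1)%N.
Proof. by move=> pq; apply: part_le. Qed.

Lemma cdel_le lam p q : (p <= q)%N -> ((part lam q).-1 <= (part lam p).-1)%N.
Proof. by move=> pq; rewrite -!subn1 leq_sub2r ?part_le. Qed.

(** lambda^(-r) and lambda^(-c), only used on [young_rfull] and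
  [young_cfull]. *)
Definition young_rdel (lam : young) : young := young_of (rdel_le lam).
Definition young_cdel (lam : young) : young := young_of (cdel_le lam).

Definition young_empty : young :=
  @young_of (fun=> 0%N) (fun _ _ _ => leqnn 0).

(** The letter d is [true] and the letter r is [false]. *)

Definition is_word (w : seq bool) :=
  (count_mem true w == n) && (count_mem false w == m).

Definition word := {w : seq bool | is_word w}.

(** [border_row lam k] is the number of boxes of lam in row epsilon_k
  (k = 1, ..., n), and 0 for k = 0. *)
Definition border_row (lam : young) (k : nat) : nat := part lam (n - k).

Definition border (lam : young) : seq bool :=
  flatten [seq rcons (nseq (border_row lam k.+1 - border_row lam k) false) true
          | k <- iota 0 n] ++ nseq (m - border_row lam n) false.

Lemma borderP lam : is_word (border lam).
Proof.
have cd k : (k <= n)%N -> count_mem true (flatten [seq rcons (nseq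
    (border_row lam i.+1 - border_row lam i) false) true | i <- iota 0 k]) = k.
  elim: k => // k IH kn; rewrite -addn1 iotaD map_cat flatten_cat count_cat.
  by rewrite IH 1?ltnW //= cats0 -cats1 count_cat count_nseq /= !mul0n.
have cr k : (k <= n)%N -> count_mem false (flatten [seq rcons (nseq
    (border_row lam i.+1 - border_row lam i) false) true | i <- iota 0 k])
    = border_row lam k.
  elim: k => [|k IH] kn.
    by rewrite /= /border_row subn0 /part insubF ?ltnn.
  rewrite -addn1 iotaD map_cat flatten_cat count_cat IH 1?ltnW //= cats0 -cats1.
  rewrite count_cat count_nseq /= mul1n add0n addn1 !addn0 subnKC //.
  by apply: part_le; rewrite leq_sub2l.
rewrite /is_word /border !count_cat cd // cr // !count_nseq /= mul0n mul1n addn0.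
by rewrite eqxx subnKC ?eqxx // part_le_m.
Qed.

Definition word_of (lam : young) : word := exist _ (border lam) (borderP lam).

Definition epss : seq (idx n m) := [seq inl i | i <- enum 'I_n].
Definition deltas : seq (idx n m) := [seq inr j | j <- enum 'I_m].

Definition is_shuffle (s : seq (idx n m)) :=
  [&& perm_eq s (enum {: idx n m}), subseq epss s & subseq deltas s].

(** Replaces the letters d (resp. r) of w by the successive entries of a
  (resp. b). *)
Fixpoint fill (w : seq bool) (a b : seq (idx n m)) : seq (idx n m) :=
  match w, a, b with
  | true :: w', x :: a', _ => x :: fill w' a' b
  | false :: w', _, y :: b' => y :: fill w' a b'
  | _, _, _ => [::]
  end.

Definition sh (w : word) : seq (idx n m) := fill (val w) epss deltas.

Definition shuffle_roots (s : seq (idx n m)) : seq (weight n m) :=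
  [seq eps ac.1 - eps ac.2 | ac <- zip s (behead s)].

Definition is_eps (a : idx n m) : bool := if a is inl _ then true else false.

Lemma epss_eps : all is_eps epss.
Proof. by rewrite all_map; apply/allP. Qed.

Lemma deltas_eps : all (predC is_eps) deltas.
Proof. by rewrite all_map; apply/allP. Qed.

Lemma fill_filters s :
  fill (map is_eps s) (filter is_eps s) (filter (predC is_eps) s) = s.
Proof. by elim: s => //= -[x|y] s IH /=; rewrite IH. Qed.

Lemma filters_fill w a b : all is_eps a -> all (predC is_eps) b ->
  count_mem true w = size a -> count_mem false w = size b ->
  [/\ filter is_eps (fill w a b) = a, filter (predC is_eps) (fill w a b) = b
    & map is_eps (fill w a b) = w].
Proof.
elim: w a b => [|[] w IH] [|x a] [|y b] //=.
- by move=> /andP[xe ae] _ /= [ca] cb; rewrite xe; have [||||-> -> ->] := IH a [::].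
- move=> /andP[xe ae] be /= [ca] cb; rewrite xe.
  by have [||||-> -> ->] := IH a (y :: b).
- move=> _ /andP[/negbTE ye be] /= ca [cb]; rewrite ye.
  by have [||||-> -> ->] := IH [::] b.
- move=> ae /andP[/negbTE ye be] /= ca [cb]; rewrite ye.
  by have [||||-> -> ->] := IH (x :: a) b.
Qed.

Lemma perm_epss_deltas : perm_eq (epss ++ deltas) (enum {: idx n m}).
Proof.
apply: uniq_perm; rewrite ?enum_uniq //.
  have ue : uniq epss by rewrite map_inj_uniq ?enum_uniq // => x y [].
  have ud : uniq deltas by rewrite map_inj_uniq ?enum_uniq // => x y [].
  rewrite cat_uniq ue ud andbT.
  by apply/hasPn => _ /mapP[y _ ->]; apply/negP => /mapP[].
by case=> x; rewrite mem_enum mem_cat; apply/orP; [left|right]; rewrite map_f ?mem_enum.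
Qed.

Lemma shuffleP s : is_shuffle s ->
  filter is_eps s = epss /\ filter (predC is_eps) s = deltas.
Proof.
have fE : filter is_eps (epss ++ deltas) = epss.
  rewrite filter_cat (all_filterP epss_eps).
  by rewrite (eq_in_filter (a2 := pred0)) ?filter_pred0 ?cats0 // => x
    /(allP deltas_eps) /negbTE.
have fD : filter (predC is_eps) (epss ++ deltas) = deltas.
  rewrite filter_cat (all_filterP deltas_eps).
  by rewrite (eq_in_filter (a2 := pred0)) ?filter_pred0 // => x
    /(allP epss_eps) /= ->.
case/and3P=> ps se sd.
have pa : perm_eq s (epss ++ deltas).
  by rewrite (perm_trans ps) // perm_sym perm_epss_deltas.
split; symmetry; apply/eqP.
- have sf : subseq epss (filter is_eps s) by rewrite subseq_filter epss_eps.
  rewrite -(size_subseq_leqif sf).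
  by have /perm_size := perm_filter is_eps pa; rewrite fE => ->.
- have sf : subseq deltas (filter (predC is_eps) s).
    by rewrite subseq_filter deltas_eps.
  rewrite -(size_subseq_leqif sf).
  by have /perm_size := perm_filter (predC is_eps) pa; rewrite fD => ->.
Qed.

Lemma filters_shuffle s : filter is_eps s = epss ->
  filter (predC is_eps) s = deltas -> is_shuffle s.
Proof.
move=> se sd; apply/and3P; split; rewrite -?se -?sd ?filter_subseq //.
by rewrite -(permPl (permEl (perm_filterC is_eps s))) se sd perm_epss_deltas.
Qed.

Lemma size_epss : size epss = n. Proof. by rewrite size_map size_enum_ord. Qed.
Lemma size_deltas : size deltas = m. Proof. by rewrite size_map size_enum_ord. Qed.

Lemma sh_filters w : [/\ filter is_eps (sh w) = epss,
  filter (predC is_eps) (sh w) = deltas & map is_eps (sh w) = val w].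
Proof.
case/andP: (valP w) => /eqP cd /eqP cr; apply: filters_fill.
- exact: epss_eps. - exact: deltas_eps. - by rewrite size_epss.
- by rewrite size_deltas.
Qed.

Lemma sh_shuffle w : is_shuffle (sh w).
Proof. by have [] := sh_filters w => a b _; exact: filters_shuffle. Qed.

Lemma sh_inj : injective sh.
Proof.
by move=> v w e; apply: val_inj; case: (sh_filters v) (sh_filters w)
  => [_ _ <-] [_ _ <-]; rewrite e.
Qed.

Lemma shuffle_word s : is_shuffle s -> is_word (map is_eps s).
Proof.
move=> /shuffleP[se sd]; rewrite /is_word !count_map.
apply/andP; split; apply/eqP.
  by rewrite -[RHS]size_epss -se size_filter; apply: eq_count => -[].
by rewrite -[RHS]size_deltas -sd size_filter; apply: eq_count => -[].
Qed.

Lemma shuffle_sh s (ss : is_shuffle s) : sh (exist _ (map is_eps s) (shuffle_word ss)) = s.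
Proof. by have [se sd] := shuffleP ss; rewrite /sh /= -se -sd fill_filters. Qed.

Lemma shuffle_uniq s : is_shuffle s -> uniq s.
Proof. by case/and3P => /perm_uniq ->; rewrite enum_uniq. Qed.

Lemma mem_shuffle s a : is_shuffle s -> a \in s.
Proof. by case/and3P => /perm_mem ->; rewrite mem_enum. Qed.

Lemma shuffle_swap s1 s2 a b : is_eps a != is_eps b ->
  is_shuffle (s1 ++ a :: b :: s2) -> is_shuffle (s1 ++ b :: a :: s2).
Proof.
move=> ab /shuffleP[se sd]; apply: filters_shuffle.
  by rewrite -se !filter_cat /=; case: (is_eps a) (is_eps b) ab => [] [].
by rewrite -sd !filter_cat /=; case: (is_eps a) (is_eps b) ab => [] [].
Qed.

Lemma eps_diff_inj (a b c d : idx n m) : a != b ->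
  eps a - eps b = eps c - eps d -> a = c /\ b = d.
Proof.
move=> ab e.
have ea := congr1 (fun f : weight n m => f a) e.
have eb := congr1 (fun f : weight n m => f b) e.
move: ea eb; rewrite !ffunE !eqxx (negbTE ab) (eq_sym b a) (negbTE ab) => ea eb.
split; apply/eqP.
  by move: ea; case: (a == c); case: (a == d).
by move: eb; case: (b == d); case: (b == c).
Qed.

Lemma adjacentP (s : seq (idx n m)) (a b : idx n m) :
  (a, b) \in zip s (behead s) <-> exists s1 s2, s = s1 ++ a :: b :: s2.
Proof.
elim: s => [|x [|y s] IH] /=.
- by split=> // -[[|? ?] [? ]].
- by split=> // -[[|? [|? ?]] [? ]].
- rewrite inE; split.
    case/orP => [/eqP[-> ->]|/IH[s1 [s2 ->]]]; first by exists [::], s.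
    by exists (x :: s1), s2.
  case=> -[|z s1] [s2] /= [-> e]; first by case: e => -> _; rewrite eqxx.
  by apply/orP; right; apply/IH; exists s1, s2.
Qed.

Lemma shuffle_rootsP s al : reflect
  (exists a b s1 s2, s = s1 ++ a :: b :: s2 /\ al = eps a - eps b)
  (al \in shuffle_roots s).
Proof.
apply: (iffP mapP) => [[[a b] /adjacentP[s1 [s2 es]] ->]|[a [b [s1 [s2 [es ->]]]]]].
  by exists a, b, s1, s2.
by exists (a, b) => //; apply/adjacentP; exists s1, s2.
Qed.

Lemma src_tgt x : is_eps (src x) != is_eps (tgt x) :> bool.
Proof. by case: x => [[] []]. Qed.

Lemma src_neq_tgt (x : isoroot n m) : src x != tgt x.
Proof. by case: x => [[] []]. Qed.

Lemma root_shuffle s x : uniq s -> root_of x \in shuffle_roots s ->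
  exists s1 s2, s = s1 ++ src x :: tgt x :: s2.
Proof.
move=> us /shuffle_rootsP[a [b [s1 [s2 [es e]]]]].
by have [-> ->] := eps_diff_inj (src_neq_tgt x) e; exists s1, s2.
Qed.

Definition wordR (x : isoroot n m) : set word :=
  [set w | root_of x \in shuffle_roots (sh w)].

(** The two letters of w at the consecutive entries src x, tgt x of sh(w) are
  replaced by rd if x is positive, by dr if x is negative; [insubd] only
  matters for w outside [wordR x]. *)
Definition word_move (x : isoroot n m) (w : word) : word :=
  let p := index (src x) (sh w) in
  insubd w (take p (val w) ++ [:: x.1; ~~ x.1] ++ drop p.+2 (val w)).

Lemma sh_move x w s1 s2 : sh w = s1 ++ src x :: tgt x :: s2 ->
  sh (word_move x w) = s1 ++ tgt x :: src x :: s2.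
Proof.
move=> e; have [_ _ ew] := sh_filters w; have us := shuffle_uniq (sh_shuffle w).
have ss : is_shuffle (s1 ++ tgt x :: src x :: s2).
  by apply: shuffle_swap (src_tgt x) _; rewrite -e sh_shuffle.
have ix : index (src x) (sh w) = size s1.
  rewrite e index_cat /= eqxx addn0 ifN //.
  by move: us; rewrite e cat_uniq /= => /and3P[_ /norP[]].
rewrite -[RHS](shuffle_sh ss); congr sh; apply: val_inj.
rewrite /word_move ix -ew e map_cat take_size_cat ?size_map //=.
rewrite drop_cat size_map ltnNge leqW ?leqnSn //= subSn ?leqnSn // subSnn /= drop0.
set t := _ ++ _.
have -> : t = map is_eps (s1 ++ tgt x :: src x :: s2).
  by rewrite /t map_cat /=; case: (x) => [[] []].
by rewrite val_insubd shuffle_word.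
Qed.

Lemma word_move_in x w : wordR x w -> wordR (neg x) (word_move x w).
Proof.
rewrite /wordR /= => xw.
have [s1 [s2 e]] := root_shuffle (shuffle_uniq (sh_shuffle w)) xw.
rewrite (sh_move e); apply/shuffle_rootsP; exists (tgt x), (src x), s1, s2.
by split=> //; case: (x) => [[] []].
Qed.

Lemma word_moveK x w : wordR x w -> word_move (neg x) (word_move x w) = w.
Proof.
move=> xw; have [s1 [s2 e]] := root_shuffle (shuffle_uniq (sh_shuffle w)) xw.
apply: sh_inj; rewrite e (@sh_move _ _ s1 s2).
  by case: (x) => [[] []].
by rewrite (sh_move e); case: (x) => [[] []].
Qed.

Definition word_functor := make_functor word_move_in word_moveK.

End Young.
Arguments is_eps {n m} _.

Section Borel.
Variables (K : fieldType) (n m : nat).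
Local Notation idx := (idx n m).
Local Notation gl := 'M[K]_(n + m).

(** The part of x of parity s (true is odd) for the block decomposition
  n + m. *)
Definition hpart (s : bool) (x : gl) : gl :=
  \matrix_(i, j) (x i j *+ (((i < n)%N != (j < n)%N) == s)).

Definition sbracket (x y : gl) : gl :=
  \sum_(s : bool) \sum_(t : bool)
    (hpart s x *m hpart t y - (-1) ^+ (s && t) *: (hpart t y *m hpart s x)).

(** For a != c, the matrix unit [root_mx a c] spans the root space of
  eps a - eps c for the Cartan subalgebra of diagonal matrices. *)
Definition root_mx (a c : idx) : gl := delta_mx (unsplit a) (unsplit c).

Definition unit_span (P : rel idx) : {vspace gl} :=
  (\sum_(a : idx) \sum_(c : idx | P a c) <[root_mx a c]>)%VS.

Definition even_part : {vspace gl} :=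
  unit_span (fun a c => is_eps a == is_eps c).

Definition even_upper_part : {vspace gl} :=
  unit_span (fun a c => (is_eps a == is_eps c) && (unsplit a <= unsplit c)%N).

(** Borel subalgebras containing the diagonal matrices: for a regular rational
  element h of the Cartan subalgebra, the sum of the root spaces g^al with
  al(h) >= 0. As a Borel subalgebra whose even part consists of the upper
  triangular matrices contains the diagonal ones, no other is needed. The
  closure under the superbracket follows from the second condition. *)
Definition is_borel (b : {vspace gl}) : Prop :=
  (forall x y, x \in b -> y \in b -> sbracket x y \in b) /\
  exists2 h : idx -> rat, injective h &
    b = unit_span (fun a c => h c <= h a).

Definition is_dist_borel (b : {vspace gl}) : bool :=
  `[< is_borel b /\ (b :&: even_part)%VS = even_upper_part >].

Definition borel := {b : {vspace gl} | is_dist_borel b}.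

Definition positive_roots (b : {vspace gl}) : set (weight n m) :=
  [set al | exists a c, [/\ a != c, al = eps a - eps c & root_mx a c \in b]].

Definition simple_roots (b : {vspace gl}) : set (weight n m) :=
  [set al | positive_roots b al /\
    ~ exists be ga, [/\ positive_roots b be, positive_roots b ga & al = be + ga]].

(** The Borel subalgebra of a shuffle s: its roots are the eps a - eps c with
  a before c in s. *)
Definition shuffle_borel (s : seq idx) : {vspace gl} :=
  unit_span (fun a c => (index a s <= index c s)%N).

Lemma unsplitP (i : 'I_(n + m)) : exists a : idx, i = unsplit a.
Proof. by exists (split i); rewrite splitK. Qed.

Lemma unsplit_inj : injective (@unsplit n m).
Proof. exact: can_inj (@unsplitK n m). Qed.

Lemma unit_spanP (P : rel idx) (x : gl) :
  reflect (forall a c, x (unsplit a) (unsplit c) != 0 -> P a c)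
    (x \in unit_span P).
Proof.
apply: (iffP idP) => [xP a c|xP].
  apply: contraNT => nP; move: xP.
  case/memv_sumP => u uP ->; rewrite summxE big1 // => a' _.
  have /memv_sumP[v vP ->] := uP a' isT; rewrite summxE big1 // => c' P'.
  have /vlineP[k ->] := vP c' P'; rewrite !mxE.
  case: eqP => [/unsplit_inj ea|]; rewrite ?mulr0 //.
  case: eqP => [/unsplit_inj ec|]; rewrite ?mulr0 //.
  by move: nP; rewrite ea ec P'.
rewrite [x]matrix_sum_delta.
have ub : {on xpredT, bijective (@unsplit n m)}.
  by exists split => i _; rewrite ?splitK ?unsplitK.
rewrite (reindex _ ub); apply: memv_sumr => a _.
rewrite (reindex _ ub) (bigID (P a)) /= [X in _ + X]big1 ?addr0; last first.
  move=> c nP; have [->|/xP Pac] := eqVneq (x (unsplit a) (unsplit c)) 0.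
    by rewrite scale0r.
  by rewrite Pac in nP.
by apply: memv_sumr => c _; apply: memvZ; exact: memv_line.
Qed.

Lemma root_mx_in (P : rel idx) a c : (root_mx a c \in unit_span P) = P a c.
Proof.
apply/unit_spanP/idP => [|Pac a' c']; first by apply; rewrite mxE !eqxx oner_eq0.
rewrite mxE; case: (unsplit a' =P unsplit a) => [/unsplit_inj ->|]; last first.
  by rewrite eqxx.
by case: (unsplit c' =P unsplit c) => [/unsplit_inj ->|]; rewrite ?eqxx.
Qed.

Lemma unit_span_inj (P Q : rel idx) : unit_span P = unit_span Q -> P =2 Q.
Proof. by move=> e a c; rewrite -!root_mx_in e. Qed.

Lemma eq_unit_span (P Q : rel idx) : P =2 Q -> unit_span P = unit_span Q.
Proof.
move=> e; apply/vspaceP => x.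
by apply/unit_spanP/unit_spanP => xP a c /xP; rewrite e.
Qed.

Lemma unit_span_cap (P Q : rel idx) :
  (unit_span P :&: unit_span Q)%VS = unit_span (fun a c => P a c && Q a c).
Proof.
apply/vspaceP => x; rewrite memv_cap.
apply/andP/unit_spanP => [[/unit_spanP xP /unit_spanP xQ] a c nz|xPQ].
  by rewrite xP ?xQ.
by split; apply/unit_spanP => a c /xPQ /andP[].
Qed.

Lemma hpart_in (P : rel idx) s x : x \in unit_span P -> hpart s x \in unit_span P.
Proof.
move=> /unit_spanP xP; apply/unit_spanP => a c; rewrite mxE => nz; apply: xP.
by apply: contraNneq nz => ->; rewrite mul0rn.
Qed.

Lemma mul_in (P : rel idx) x y : transitive P ->
  x \in unit_span P -> y \in unit_span P -> x *m y \in unit_span P.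
Proof.
move=> Ptr /unit_spanP xP /unit_spanP yP; apply/unit_spanP => a c.
rewrite mxE; apply: contraNT => nP; apply/eqP; apply: big1 => i _.
have [d ->] := unsplitP i; apply/eqP; rewrite mulf_eq0.
apply: contraNT nP; rewrite negb_or => /andP[/xP ad /yP dc].
exact: Ptr ad dc.
Qed.

Lemma sbracket_in (P : rel idx) x y : transitive P ->
  x \in unit_span P -> y \in unit_span P -> sbracket x y \in unit_span P.
Proof.
move=> Ptr xP yP; apply: memv_suml => s _; apply: memv_suml => t _.
by rewrite memvB ?memvZ // mul_in ?hpart_in.
Qed.

Lemma index_filter (p : pred idx) (s : seq idx) a c : p a -> p c ->
  (index a (filter p s) <= index c (filter p s))%N = (index a s <= index c s)%N.
Proof.
move=> pa pc; elim: s => //= x s IH.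
have [px|npx] /= := boolP (p x); first by do 2 case: eqP => //.
have /negbTE -> : x != a by apply: contraNneq npx => ->.
have /negbTE -> : x != c by apply: contraNneq npx => ->.
by rewrite ltnS.
Qed.

Lemma index_epss (i k : 'I_n) :
  (index (inl i : idx) (epss n m) <= index (inl k) (epss n m))%N = (i <= k)%N.
Proof. by rewrite !(index_map inl_inj) !index_enum_ord. Qed.

Lemma index_deltas (i k : 'I_m) :
  (index (inr i : idx) (deltas n m) <= index (inr k) (deltas n m))%N = (i <= k)%N.
Proof. by rewrite !(index_map inr_inj) !index_enum_ord. Qed.

Lemma shuffle_even s (a c : idx) : is_shuffle s -> is_eps a = is_eps c ->
  (index a s <= index c s)%N = (unsplit a <= unsplit c)%N.
Proof.
move=> /shuffleP[se sd]; case: a c => [i|i] [k|k] //= _.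
  by rewrite -(@index_filter is_eps) // se index_epss.
by rewrite -(@index_filter (predC is_eps)) // sd index_deltas leq_add2l.
Qed.

Lemma shuffle_borelP s : is_shuffle s -> is_dist_borel (shuffle_borel s).
Proof.
move=> ss; apply/asboolP; split; last first.
  rewrite unit_span_cap; apply: eq_unit_span => a c.
  have [e|_] := eqVneq (is_eps a) (is_eps c); last by rewrite andbF.
  by rewrite andbT shuffle_even.
split; first by move=> x y; apply: sbracket_in => a b c; exact: leq_trans.
exists (fun a => - (index a s)%:R).
  move=> a b /oppr_inj /eqP; rewrite eqr_nat => /eqP.
  by apply: (index_inj a); exact: mem_shuffle.
by apply: eq_unit_span => a c; rewrite lerN2 ler_nat.
Qed.

Definition borel_of (w : word n m) : borel :=
  exist _ (shuffle_borel (sh w)) (shuffle_borelP (sh_shuffle w)).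

Lemma borel_shuffle (b : borel) : exists2 s, is_shuffle s & val b = shuffle_borel s.
Proof.
case: b => b /= /asboolP[[_ [h hinj eb]] ev].
pose r (a c : idx) := h c <= h a.
have rtot : total r by move=> a c; exact: le_total.
have rtr : transitive r by move=> a c d ca ad; exact: le_trans ad ca.
have ras : antisymmetric r by move=> a c /le_anti /hinj.
pose s := sort r (enum {: idx}).
have us : uniq s by rewrite sort_uniq enum_uniq.
have ss : sorted r s by apply: sort_sorted.
have rs : all (mem s) s by apply/allP.
have smem a : a \in s by rewrite mem_sort mem_enum.
have si a c : (index a s <= index c s)%N = r a c.
  apply/idP/idP => [|rac]; last first.
    rewrite leqNgt; apply/negP => lt.
    have rca := sorted_ltn_index rtr ss c a (smem c) (smem a) lt.
    by have eac : a = c := ras a c (introT andP (conj rac rca)); rewrite eac ltnn in lt.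
  rewrite leq_eqVlt => /orP[/eqP|].
    by move/(index_inj a (smem a) (smem c)) => ->; rewrite /r.
  exact: (sorted_ltn_index rtr ss).
exists s; last by rewrite eb; apply: eq_unit_span => a c; rewrite si.
have evr (a c : idx) : is_eps a = is_eps c -> r a c = (unsplit a <= unsplit c)%N.
  move=> e; move: ev; rewrite eb unit_span_cap => /unit_span_inj/(_ a c).
  by rewrite e eqxx andbT.
have sorted_eq_s (p : pred idx) (t : seq idx) : (forall a c, p a -> p c ->
    is_eps a = is_eps c) -> all p t ->
    sorted (fun a c : idx => unsplit a <= unsplit c)%N t -> uniq t ->
    (forall a, p a -> a \in t) -> filter p s = t.
  move=> pe pt st ut mt; apply: (sorted_eq rtr ras).
  - exact: sorted_filter.
  - apply: (sub_in_sorted (P := p)) st; last exact: pt.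
    by move=> a c pa pc le_ac; rewrite evr //; exact: pe.
  - apply: uniq_perm; rewrite ?filter_uniq // => a.
    rewrite mem_filter smem andbT; apply/idP/idP; first exact: mt.
    by move/(allP pt).
apply: filters_shuffle; apply: sorted_eq_s.
- by case=> x [].
- exact: epss_eps.
- rewrite sorted_map /relpre /=; have := iota_sorted 0 n.
  by rewrite -val_enum_ord sorted_map.
- by rewrite map_inj_uniq ?enum_uniq // => x y [].
- by case=> // i _; rewrite map_f ?mem_enum.
- by case=> x [].
- exact: deltas_eps.
- rewrite sorted_map /relpre /=; have := iota_sorted 0 m.
  rewrite -val_enum_ord sorted_map; apply: sub_sorted => i k /=.
  by rewrite leq_add2l.
- by rewrite map_inj_uniq ?enum_uniq // => x y [].
- by case=> // i _; rewrite map_f ?mem_enum.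
Qed.

Lemma shuffle_borel_inj s t : is_shuffle s -> is_shuffle t ->
  shuffle_borel s = shuffle_borel t -> s = t.
Proof.
move=> ss st /unit_span_inj e.
pose r (a c : idx) := (index a s <= index c s)%N.
have ir u : is_shuffle u ->
    (forall a c, (index a u <= index c u)%N = r a c) -> sorted r u.
  move=> su eu; case eu0: u => [//|x0 u']; rewrite -eu0.
  apply/(sortedP x0) => i iu; rewrite -eu !index_uniq ?shuffle_uniq //.
  exact: ltnW.
have rtr : transitive r by move=> a c d; exact: leq_trans.
have ras : antisymmetric r.
  by move=> a c /anti_leq /(index_inj a (mem_shuffle a ss) (mem_shuffle c ss)).
apply: (sorted_eq rtr ras); [exact: ir|by apply: ir => // a c; rewrite -e|].
by case/and3P: ss => ps _ _; case/and3P: st => pt _ _;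
  rewrite (permPl ps) perm_sym.
Qed.

Lemma positive_shuffle s al : positive_roots (shuffle_borel s) al <->
  exists a c, [/\ a != c, al = eps a - eps c & (index a s <= index c s)%N].
Proof. by split=> -[a [c [? ? h]]]; exists a, c; split=> //; rewrite root_mx_in in h *. Qed.

Lemma index_adjacent (s1 s2 : seq idx) a c : uniq (s1 ++ a :: c :: s2) ->
  index a (s1 ++ a :: c :: s2) = size s1 /\
  index c (s1 ++ a :: c :: s2) = (size s1).+1.
Proof.
rewrite cat_uniq /= negb_or => /and3P[_ /andP[na /norP[nc _]] /andP[+ _]].
rewrite inE negb_or => /andP[ac _].
rewrite !index_cat (negbTE na) (negbTE nc) /= !eqxx (negbTE ac).
by rewrite addn0 addn1.
Qed.

Lemma split_adjacent (s : seq idx) x0 i : (i.+1 < size s)%N ->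
  s = take i s ++ nth x0 s i :: nth x0 s i.+1 :: drop i.+2 s.
Proof. by move=> lt; rewrite -!drop_nth ?cat_take_drop // ltnW. Qed.

Lemma simple_shuffle s al : is_shuffle s ->
  simple_roots (shuffle_borel s) al <-> al \in shuffle_roots s.
Proof.
move=> ss; have us := shuffle_uniq ss.
pose ht (x : weight n m) : int := \sum_a x a * (index a s)%:Z.
have htD x y : ht (x + y) = ht x + ht y.
  by rewrite /ht -big_split; apply: eq_bigr => a _; rewrite ffunE mulrDl.
have hte a : ht (eps a) = (index a s)%:Z.
  rewrite /ht (bigD1 a) //= big1 ?addr0 ?ffunE ?eqxx ?mul1r // => c /negbTE ca.
  by rewrite ffunE ca mul0r.
have htB a c : ht (eps a - eps c) = (index a s)%:Z - (index c s)%:Z.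
  by apply: (addIr (ht (eps c))); rewrite -htD !subrK hte -(hte c) addrNK.
have lt_index a c : a != c -> (index a s <= index c s)%N -> (index a s < index c s)%N.
  move=> ac; rewrite leq_eqVlt => /orP[/eqP|//].
  by move/(index_inj a (mem_shuffle a ss) (mem_shuffle c ss)) => e; rewrite e eqxx in ac.
split=> [[/positive_shuffle[a [c [ac -> le_ac]]] indec]|].
  have lt_ac := lt_index _ _ ac le_ac.
  have lt_cs : (index c s < size s)%N by rewrite index_mem mem_shuffle.
  have lt_as := leq_ltn_trans lt_ac lt_cs.
  apply/shuffle_rootsP; exists a, (nth a s (index a s).+1).
  exists (take (index a s) s), (drop (index a s).+2 s).
  rewrite -{2}(nth_index a (mem_shuffle a ss)) -split_adjacent //; split=> //.
  set d := nth a s _; have [->//|dc] := eqVneq d c; case: indec.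
  have id_ : index d s = (index a s).+1 by rewrite index_uniq.
  have ad : a != d.
    by apply/eqP => e; move: id_; rewrite -e => /eqP; rewrite (ltn_eqF (ltnSn _)).
  exists (eps a - eps d), (eps d - eps c); split.
  - by apply/positive_shuffle; exists a, d; rewrite id_ leqnSn.
  - by apply/positive_shuffle; exists d, c; rewrite id_ lt_ac.
  - by rewrite addrA subrK.
case/shuffle_rootsP => a [c [s1 [s2 [es ->]]]].
have [ia ic] : index a s = size s1 /\ index c s = (size s1).+1.
  by rewrite es; apply: index_adjacent; rewrite -es.
split.
  apply/positive_shuffle; exists a, c; rewrite ia ic leqnSn; split=> //.
  by apply/eqP => e; move: ic; rewrite -e ia => /eqP; rewrite (ltn_eqF (ltnSn _)).
case=> be [ga [/positive_shuffle[x [y [xy -> /(lt_index _ _ xy) lxy]]]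
  /positive_shuffle[z [t [zt -> /(lt_index _ _ zt) lzt]]]]].
move/(congr1 ht); rewrite htB htD !htB ia ic; lia.
Qed.

Lemma simple_roots_inj (b b' : borel) :
  simple_roots (val b) = simple_roots (val b') -> b = b'.
Proof.
move=> e; apply: val_inj; move: e.
have [s ss ->] := borel_shuffle b; have [t st ->] := borel_shuffle b'.
move=> e; congr shuffle_borel.
pose r (a c : idx) := (index a t <= index c t)%N.
have rtr : transitive r by move=> a c d; exact: leq_trans.
have ras : antisymmetric r.
  by move=> a c /anti_leq /(index_inj a (mem_shuffle a st) (mem_shuffle c st)).
have ir u : is_shuffle u -> {subset shuffle_roots u <= shuffle_roots t} -> sorted r u.
  move=> su sub; case eu0: u => [//|x0 u']; rewrite -eu0.
  apply/(sortedP x0) => i iu; set a := nth x0 u i; set c := nth x0 u i.+1.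
  have nac : a != c by rewrite nth_uniq ?shuffle_uniq ?(ltn_eqF (ltnSn _)) // ltnW.
  have : eps a - eps c \in shuffle_roots u.
    by apply/shuffle_rootsP; exists a, c, (take i u), (drop i.+2 u);
      rewrite -split_adjacent.
  move/sub/shuffle_rootsP => [a' [c' [s1 [s2 [et e']]]]].
  have [ea ec] := eps_diff_inj nac e'; rewrite -ea -ec in et.
  have := shuffle_uniq st; rewrite /r et => /index_adjacent[-> ->].
  exact: leqnSn.
apply: (sorted_eq rtr ras); [apply: ir => // al|exact: ir|].
  by move/(simple_shuffle al ss); rewrite e => /(simple_shuffle al st).
by case/and3P: ss => ps _ _; case/and3P: st => pt _ _;
  rewrite (permPl ps) perm_sym.
Qed.

Definition reflect_root (al be : weight n m) : weight n m :=
  if be == al then - al else if `[< is_root (al + be) >] then al + be else be.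

Definition borelR (x : isoroot n m) : set borel :=
  [set b | simple_roots (val b) (root_of x)].

(** The Borel subalgebra whose simple roots are the reflected simple roots of
  b; it exists and is unique for b in [borelR x]. *)
Definition borel_move (x : isoroot n m) (b : borel) : borel :=
  xget b [set b' : borel | simple_roots (val b') =
    reflect_root (root_of x) @` simple_roots (val b)].

Section ReflectRoot.
Variables a b : idx.
Hypothesis ab : a != b.
Let f := reflect_root (eps a - eps b).

Lemma reflect_self : f (eps a - eps b) = eps b - eps a.
Proof. by rewrite /f /reflect_root eqxx opprB. Qed.

Lemma reflect_left z : z != a -> z != b -> f (eps z - eps a) = eps z - eps b.
Proof.
move=> za zb; have e : eps a - eps b + (eps z - eps a) = eps z - eps b.
  by rewrite addrC addrA subrK.
rewrite /f /reflect_root ifN; last first.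
  by apply/eqP => /(eps_diff_inj za)[ea _]; rewrite ea eqxx in za.
by rewrite e; case: asboolP => // -[]; exists z, b.
Qed.

Lemma reflect_right z : z != a -> z != b -> f (eps b - eps z) = eps a - eps z.
Proof.
move=> za zb; have e : eps a - eps b + (eps b - eps z) = eps a - eps z.
  by rewrite addrA subrK.
rewrite /f /reflect_root ifN; last first.
  rewrite eq_sym in zb.
  apply/eqP => /(eps_diff_inj zb)[ea _]; by have := ab; rewrite ea eqxx.
by rewrite e; case: asboolP => // -[]; exists a, z; rewrite eq_sym.
Qed.

Lemma reflect_fix x y : x != y -> x != a -> x != b -> y != a -> y != b ->
  f (eps x - eps y) = eps x - eps y.
Proof.
move=> xy xa xb ya yb; rewrite /f /reflect_root ifN; last first.
  by apply/eqP => /(eps_diff_inj xy)[ea _]; rewrite ea eqxx in xa.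
case: asboolP => // -[p [q [pq e]]].
have ea := congr1 (fun f : weight n m => f a) e.
have ex := congr1 (fun f : weight n m => f x) e.
move: ea ex; rewrite !ffunE !eqxx (negbTE ab) (negbTE xa) (negbTE xb) (negbTE xy).
rewrite (eq_sym a x) (negbTE xa) (eq_sym a y) (negbTE ya).
have [<-|_] := eqVneq a p; last by case: (a == q).
by rewrite (negbTE xa); case: (x == q).
Qed.

Lemma shuffle_roots_cons x y s : shuffle_roots [:: x, y & s : seq idx] =
  (eps x - eps y) :: shuffle_roots (y :: s).
Proof. by []. Qed.

Lemma reflect_shuffle s1 s2 : uniq (s1 ++ a :: b :: s2) ->
  shuffle_roots (s1 ++ b :: a :: s2) = map f (shuffle_roots (s1 ++ a :: b :: s2)).
Proof.
have fixed s : uniq s -> a \notin s -> b \notin s ->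
    map f (shuffle_roots s) = shuffle_roots s.
  elim: s => [|x [|y s] IH] // us; rewrite !inE !negb_or.
  move=> /and3P[ax ay as_] /and3P[bx by_ bs].
  rewrite shuffle_roots_cons map_cons IH ?inE ?negb_or ?ay ?by_ //; last first.
    by case/andP: us.
  rewrite reflect_fix ?(eq_sym _ a) ?(eq_sym _ b) //.
  by move: us; rewrite /= inE negb_or => /andP[/andP[]].
elim: s1 => [|x [|y s1] IH].
- rewrite !cat0s !cons_uniq inE negb_or => /and3P[/andP[_ as2] bs2 us2].
  rewrite shuffle_roots_cons [in RHS]shuffle_roots_cons map_cons reflect_self.
  congr cons; case: s2 as2 bs2 us2 => [//|c s2] as2 bs2 us2.
  rewrite !shuffle_roots_cons map_cons fixed // reflect_right //.
    by apply: contraNneq as2 => ->; rewrite inE eqxx.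
  by apply: contraNneq bs2 => ->; rewrite inE eqxx.
- rewrite !cat1s cons_uniq => /andP[+ us]; rewrite !inE !negb_or => /and3P[xa xb _].
  rewrite [LHS]shuffle_roots_cons [in RHS]shuffle_roots_cons map_cons.
  by rewrite reflect_left //; congr cons; exact: IH.
- rewrite !cat_cons cons_uniq => /andP[+ us].
  rewrite inE mem_cat !inE !negb_or => /and3P[xy _ /and3P[xa xb _]].
  have [ya yb] : y != a /\ y != b.
    move: us => /andP[+ _]; rewrite mem_cat !inE !negb_or.
    by case/andP=> _ /and3P[].
  rewrite [LHS]shuffle_roots_cons [in RHS]shuffle_roots_cons map_cons.
  by rewrite reflect_fix //; congr cons; exact: IH.
Qed.

End ReflectRoot.

Lemma simple_moved x s1 s2 : let s := s1 ++ src x :: tgt x :: s2 in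
  is_shuffle s -> is_shuffle (s1 ++ tgt x :: src x :: s2) /\
  simple_roots (shuffle_borel (s1 ++ tgt x :: src x :: s2)) =
    reflect_root (root_of x) @` simple_roots (shuffle_borel s).
Proof.
move=> s ss; have ss' : is_shuffle (s1 ++ tgt x :: src x :: s2).
  exact: shuffle_swap (src_tgt x) ss.
split=> //; apply/seteqP; split=> al.
  move/(simple_shuffle _ ss').
  rewrite (reflect_shuffle (src_neq_tgt x)) ?shuffle_uniq //.
  by case/mapP => be /(simple_shuffle _ ss) sb ->; exists be.
case=> be /(simple_shuffle _ ss) sb <-; apply/(simple_shuffle _ ss').
by rewrite (reflect_shuffle (src_neq_tgt x)) ?shuffle_uniq // map_f.
Qed.

Lemma borel_moveE x (b : borel) s1 s2 : let s := s1 ++ src x :: tgt x :: s2 in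
  is_shuffle s -> val b = shuffle_borel s ->
  val (borel_move x b) = shuffle_borel (s1 ++ tgt x :: src x :: s2).
Proof.
move=> s ss eb; have [ss' e] := simple_moved ss.
pose b' : borel := exist _ (shuffle_borel _) (shuffle_borelP ss').
suff -> : borel_move x b = b' by [].
apply: xget_unique => [|b'' eb'']; first by rewrite /= e eb.
by apply: simple_roots_inj; rewrite eb'' eb -e.
Qed.

Lemma borelRP x (b : borel) : borelR x b -> exists s1 s2,
  is_shuffle (s1 ++ src x :: tgt x :: s2) /\
  val b = shuffle_borel (s1 ++ src x :: tgt x :: s2).
Proof.
rewrite /borelR /=; have [s ss ->] := borel_shuffle b.
move/(simple_shuffle _ ss)/(root_shuffle (shuffle_uniq ss)) => [s1 [s2 e]].
by exists s1, s2; rewrite -e.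
Qed.

Lemma srcN x : src (neg x) = tgt x :> idx. Proof. by case: x => [[] []]. Qed.
Lemma tgtN x : tgt (neg x) = src x :> idx. Proof. by case: x => [[] []]. Qed.

Lemma borel_move_in x b : borelR x b -> borelR (neg x) (borel_move x b).
Proof.
move=> /borelRP[s1 [s2 [ss eb]]]; have [ss' _] := simple_moved ss.
rewrite /borelR /= (borel_moveE ss eb); apply/(simple_shuffle _ ss').
by apply/shuffle_rootsP; exists (tgt x), (src x), s1, s2; rewrite /root_of srcN tgtN.
Qed.

Lemma borel_moveK x b : borelR x b -> borel_move (neg x) (borel_move x b) = b.
Proof.
move=> /borelRP[s1 [s2 [ss eb]]]; have [ss' _] := simple_moved ss.
have eb' := borel_moveE ss eb.
apply: val_inj; rewrite (@borel_moveE (neg x) _ s1 s2) srcN tgtN //.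
Qed.

Definition borel_functor := make_functor borel_move_in borel_moveK.

End Borel.

(** A set with an action of T_iso, the subsets (r.full) and (c.full) and the
  maps x^(-r) and x^(-c); the values of [rdel] (resp. [cdel]) outside [rfull]
  (resp. [cfull]) are irrelevant. *)
Record action_data (n m : nat) := ActionData {
  carrier :> Type;
  act : functor (Tiso n m) (subset_groupoid carrier);
  rfull : set carrier;
  cfull : set carrier;
  rdel : carrier -> carrier;
  cdel : carrier -> carrier }.

Section Actions.
Variables n m : nat.

Definition young_action : action_data n m :=
  ActionData (young_functor n m) (@young_rfull n m) (@young_cfull n m)
    (@young_rdel n m) (@young_cdel n m).

(** For g bijective, [ginv g] is its inverse; the default is never used. *)
Definition ginv (Y : Type) (g : young n m -> Y) (y : Y) : young n m :=
  xget (young_empty n m) [set lam | g lam = y].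

Definition transported (Y : Type) (g : young n m -> Y)
    (H : functor (Tiso n m) (subset_groupoid Y)) : action_data n m :=
  ActionData H (g @` @young_rfull n m) (g @` @young_cfull n m)
    (fun y => g (young_rdel (ginv g y))) (fun y => g (young_cdel (ginv g y))).

Definition word_action : action_data n m :=
  transported (@word_of n m) (word_functor n m).

Definition borel_action (K : fieldType) : action_data n m :=
  transported (fun lam => borel_of K (word_of lam)) (borel_functor K n m).

End Actions.

Variant model := Diagrams | Words | Borels.

Definition model_action (K : fieldType) (n m : nat) (M : model) : action_data n m :=
  match M with
  | Diagrams => young_action n m
  | Words => word_action n m
  | Borels => borel_action n m K
  end.

Section Classes.
Variables (n m : nat) (D : action_data n m).

(** [actr x] is H(rho_al)(x) for x in H(al). *)
Definition dom (al : isoroot n m) : set D := act D al.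
Definition actr (al : isoroot n m) (x : dom al) : D := app (fmap (act D) (rho al)) x.

Inductive step : D * int -> D * int -> Prop :=
| step_r x k : rfull x -> step (x, k) (rdel x, k + m%:Z)
| step_c x k : cfull x -> step (x, k) (cdel x, k + n%:Z).

Definition equiv : D * int -> D * int -> Prop :=
  Relation_Operators.clos_refl_sym_trans _ step.

Definition classes : set (set (D * int)) :=
  [set C | exists p, C = [set q | equiv p q]].

Lemma class_in (p : D * int) : [set q | equiv p q] \in classes.
Proof. by apply: mem_set; exists p. Qed.

Definition cls (x : D) (k : int) : classes := 
  exist _ [set q | equiv (x, k) q] (class_in (x, k)).

Definition classR (al : isoroot n m) : set classes :=
  [set C : classes | exists (i j : int) (x : D),
    val C (x, i * n%:Z + j * m%:Z) /\ dom (etanu i j al) x].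

End Classes.
Arguments dom {n m} D al.
Arguments actr {n m D al} x.
Arguments classes {n m} D.
Arguments classR {n m} D al.

(* Main.v *)
Require Import Defs.
From HB Require Import structures.
From mathcomp Require Import all_boot all_order all_algebra.
From mathcomp Require Import boolp classical_sets.
From mathcomp Require Import zify ring.

Set Implicit Arguments.
Unset Strict Implicit.
Unset Printing Implicit Defensive.

Import Order.TTheory GRing.Theory Num.Theory.

Local Open Scope classical_set_scope.
Local Open Scope ring_scope.

(** Read the border of a diagram as a closed walk in the integers starting at
  height k, in which a right step adds n and a down step subtracts m: it ends
  where it starts, and both generators of the equivalence relation only rotate
  its starting point. Hence the set of heights at which down steps start is an
  invariant of the class [x, k]. As n and m are coprime, these n heights have
  distinct residues modulo n, so for a given k they determine x; as the walk
  can be rotated to start at any of them, they determine the class. For k =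
  i n + j m the residue of the down step of row a is that of m (j - a), so
  rho_alpha moves by n or -n the unique height in a residue class that depends
  only on alpha, and therefore acts on classes. Words and Borel subalgebras
  reduce to diagrams, the boxes of a diagram being the pairs (down step, right
  step) in which the right step comes first. *)

(** * Initial segments of ordinals and integer powers of a map *)

Lemma card_ord_ltn m j : (j <= m)%N -> #|[set q : 'I_m | (q < j)%N]%SET| = j.
Proof.
move=> jm; rewrite cardsE -sum1_card /=.
by rewrite -(big_ord_widen _ (fun=> 1%N) jm) sum1_card card_ord.
Qed.

(** A down-closed set of ordinals is an initial segment, hence determined by its size. This recovers
    the boxes of a row from their number. *)
Lemma down_closed_card m (A : {set 'I_m}) (j : 'I_m) :
  (forall p q : 'I_m, (p <= q)%N -> q \in A -> p \in A) ->
  (j < #|A|)%N = (j \in A).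
Proof.
move=> down; apply/idP/idP => [|jA].
  apply: contraTT => jA; rewrite -leqNgt -[leqRHS](card_ord_ltn (ltnW (ltn_ord j))).
  apply/subset_leq_card/fintype.subsetP => q qA; rewrite inE ltnNge.
  by apply: contra jA => jq; apply: down qA.
rewrite -[leqLHS](card_ord_ltn (ltn_ord j)); apply/subset_leq_card/fintype.subsetP => q.
by rewrite inE ltnS => qj; apply: down jA.
Qed.

Section Iterz.
Variables (T : finType) (f : T -> T).

Lemma iterz_inv (R : Type) (P : T -> R) k x : (forall y, P (f y) = P y) ->
  P (iterz f k x) = P x.
Proof.
have iterP g : (forall y, P (g y) = P y) -> forall p y, P (iter p g y) = P y.
  by move=> Pg p y; elim: p => //= p <-.
(* [finv f y] is by definition an iterate of [f] at [y], so the same induction covers negative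
   exponents. *)
by move=> Pf; case: k => p; apply: (iterP) => // y; exact: iterP.
Qed.

Lemma iterz_comm (h : T -> T) k x : injective f -> (forall y, f (h y) = h (f y)) ->
  iterz f k (h x) = h (iterz f k x).
Proof.
move=> fI fh; have ci g : (forall y, g (h y) = h (g y)) ->
    forall p, iter p g (h x) = h (iter p g x) by move=> gh; elim=> //= p ->.
case: k => p /=; first exact: ci.
have /ci/(_ p.+1) // : forall y, finv f (h y) = h (finv f y).
by move=> y; apply: (fI); rewrite fh !f_finv.
Qed.

End Iterz.

(** * Rotation of the odd roots *)

Section Rotation.
Variables n m : nat.

Lemma nu_root_inj : injective (@nu_root n m).
Proof.
apply: (can_inj (g := fun x => (x.1, (ord_pred x.2.1, x.2.2)))) => -[s [i j]].
by rewrite /nu_root /= ordSK.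
Qed.

Lemma eta_root_inj : injective (@eta_root n m).
Proof.
apply: (can_inj (g := fun x => (x.1, (x.2.1, ordS x.2.2)))) => -[s [i j]].
by rewrite /eta_root /= ord_predK.
Qed.

Lemma etanu_neg i j (x : isoroot n m) : etanu i j (neg x) = neg (etanu i j x).
Proof.
rewrite /etanu (@iterz_comm _ _ (@neg n m) j _ nu_root_inj) //.
exact: (@iterz_comm _ _ (@neg n m) i _ eta_root_inj).
Qed.

Lemma etanu_sign i j (x : isoroot n m) : (etanu i j x).1 = x.1.
Proof. by rewrite /etanu !(@iterz_inv _ _ _ (fun y : isoroot n m => y.1)). Qed.

(** [eta_root] fixes the row and [nu_root] raises it by one modulo [n], so only the exponent [j]
    counts. *)
Lemma etanu_row i j (x : isoroot n m) :
  (n%:Z %| (etanu i j x).2.1%:Z - x.2.1%:Z - j)%Z.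
Proof.
rewrite /etanu (@iterz_inv _ _ _ (fun y : isoroot n m => y.2.1)) //.
have rowI (g : isoroot n m -> isoroot n m) (e : int) :
    (forall y, (n%:Z %| (g y).2.1%:Z - y.2.1%:Z - e)%Z) ->
    forall p, (n%:Z %| (iter p g x).2.1%:Z - x.2.1%:Z - e * p%:Z)%Z.
  move=> gP; elim=> [|p IH]; first by rewrite /= mulr0 subrr subr0 dvdz0.
  have -> : (iter p.+1 g x).2.1%:Z - x.2.1%:Z - e * p.+1%:Z =
      ((iter p.+1 g x).2.1%:Z - (iter p g x).2.1%:Z - e) +
      ((iter p g x).2.1%:Z - x.2.1%:Z - e * p%:Z) by lia.
  by rewrite rpredD ?gP.
have nuS (y : isoroot n m) : (n%:Z %| (nu_root y).2.1%:Z - y.2.1%:Z - 1)%Z.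
  have e : (y.2.1.+1 = y.2.1.+1 %/ n * n + (nu_root y).2.1)%N := divn_eq _ _.
  by apply/dvdzP; exists (- (y.2.1.+1 %/ n)%:Z); lia.
case: j => p; first by have := rowI _ _ nuS p; rewrite mul1r.
have /rowI/(_ p.+1) : forall y : isoroot n m,
    (n%:Z %| (finv (@nu_root n m) y).2.1%:Z - y.2.1%:Z - (- 1))%Z.
  move=> y; have := nuS (finv (@nu_root n m) y); rewrite f_finv; last exact: nu_root_inj.
  by rewrite -rpredN !opprB opprK addrA -(addrC 1) addrA.
by rewrite mulN1r.
Qed.

End Rotation.

(** * Row lengths and heights of a diagram *)

Section Heights.
Variables n m : nat.
Implicit Types (lam mu : young n m) (x : isoroot n m) (k : int).

(** Rows are counted from the top of the rectangle and parts from the bottom, whence [rev_ord]; thus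
    [row_len lam] is nondecreasing. *)
Definition row_len lam (a : 'I_n) : nat := part lam (rev_ord a).

Lemma in_boxes lam a (b : 'I_m) : ((a, b) \in boxes lam) = (b < row_len lam a)%N.
Proof. by rewrite inE. Qed.

Lemma row_le_m lam a : (row_len lam a <= m)%N. Proof. exact: part_le_m. Qed.

Lemma row_le lam (a c : 'I_n) : (a <= c)%N -> (row_len lam a <= row_len lam c)%N.
Proof. by move=> ac; apply: part_le; rewrite /= leq_sub2l. Qed.

Lemma row_card lam a : row_len lam a = #|[set b | (a, b) \in boxes lam]%SET|.
Proof.
rewrite -[LHS](card_ord_ltn (row_le_m lam a)).
by congr #|pred_of_set _|; apply/setP => b; rewrite !inE.
Qed.

Lemma row_inj lam mu : row_len lam =1 row_len mu -> lam = mu.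
Proof.
by move=> e; apply: boxes_inj; apply/setP => -[a b]; rewrite !in_boxes e.
Qed.

(** A move is specified only by its set of boxes, so row lengths are compared as cardinalities. *)
Lemma row_move x lam (c : 'I_n) : youngR x lam ->
  (row_len (young_move x lam) c)%:Z =
  (row_len lam c)%:Z + (if c == x.2.1 then (-1) ^+ x.1 else 0).
Proof.
move=> xl; rewrite !row_card (boxes_move xl).
case: xl => bx _; case: x bx => s [a b] /= bx; rewrite /toggle /=.
have [->|ca] := eqVneq c a; last first.
  rewrite addr0; congr (#|pred_of_set _|%:Z); apply/setP => d.
  by case: s {bx} => /=; rewrite !inE xpair_eqE (negbTE ca).
set A := [set d | (a, d) \in boxes lam]%SET; have bA : (b \in A) = s by rewrite inE.
case: s bA {bx} => bA.
  rewrite (cardsD1 b A) bA (_ : finset _ = (A :\ b)%SET); first by rewrite PoszD expr1 addrAC subrr add0r.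
  by apply/setP => d; rewrite !inE xpair_eqE eqxx.
rewrite (_ : finset _ = (b |: A)%SET) ?cardsU1 ?bA; first by rewrite PoszD expr0 addrC.
by apply/setP => d; rewrite !inE xpair_eqE eqxx.
Qed.

Lemma row_rfull lam (a : 'I_n) : young_rfull lam -> a = n.-1 :> nat -> row_len lam a = m.
Proof. by move=> <- an; rewrite /row_len /= an; congr part; lia. Qed.

Lemma conj_partE lam j :
  conj_part lam j = #|[set p : 'I_n | (j <= part lam p)%N]%SET|.
Proof.
by apply: eq_card => p; rewrite [in RHS]inE; apply/idP/idP => [/set_mem|/mem_set].
Qed.

Lemma row_cfull lam (a : 'I_n) : young_cfull lam -> (0 < row_len lam a)%N.
Proof.
rewrite /young_cfull /= conj_partE => e.
have /eqP/setP/(_ (rev_ord a)) : [set p : 'I_n | (0 < part lam p)%N]%SET == finset.setT.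
  by rewrite eqEcard finset.subsetT cardsT card_ord e leqnn.
by rewrite !inE.
Qed.

Lemma cfull_row lam : (forall a, 0 < row_len lam a)%N -> young_cfull lam.
Proof.
move=> pos; rewrite /young_cfull /= conj_partE -[RHS]card_ord -cardsT.
by congr #|pred_of_set _|; apply/setP => p; rewrite !inE -[p]rev_ordK; exact: pos.
Qed.

Lemma row_cdel lam a : row_len (young_cdel lam) a = (row_len lam a).-1.
Proof. by rewrite /row_len part_young_of // (leq_trans (leq_pred _)) ?part_le_m. Qed.

Lemma part_over lam p : (n <= p)%N -> part lam p = 0%N.
Proof. by move=> np; rewrite /part insubF // ltnNge np. Qed.

(** Removing the bottom row moves the other rows down by one: row [a] of the result is row [a - 1]
    of [lam], which is [part lam (n - a)], and the new top row is empty. *)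
Lemma row_rdel lam a :
  row_len (young_rdel lam) a = if a == 0%N :> nat then 0%N else part lam (n - a).
Proof.
rewrite /row_len part_young_of ?part_le_m ?ltn_ord //=; have an := ltn_ord a.
case: eqP => [->|a0]; first by rewrite part_over //; lia.
by congr part; lia.
Qed.

Lemma radd_le lam p q : (p <= q)%N ->
  ((if q is q'.+1 then part lam q' else m) <= (if p is p'.+1 then part lam p' else m))%N.
Proof. by case: q p => [|q] [|p] // pq; [exact: part_le_m|exact: part_le]. Qed.

(** Undoes the removal of a full row: a part [m] is put in front and the last part, 0 when the top
    row is empty, falls off. *)
Definition young_radd lam : young n m := young_of n m (radd_le lam).

Lemma part_radd lam p : (p < n)%N ->
  part (young_radd lam) p = if p is p'.+1 then part lam p' else m.
Proof. by move=> pn; rewrite part_young_of //; case: p pn => // p _; exact: part_le_m. Qed.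

Lemma raddK lam : part lam n.-1 = 0%N -> young_rdel (young_radd lam) = lam.
Proof.
move=> l0; apply: row_inj => a; rewrite row_rdel; have an := ltn_ord a.
case: eqP => [a0|a0]; first by rewrite /row_len /= a0 subn1 l0.
rewrite part_radd; last by lia.
case e: (n - a)%N => [|p]; first by lia.
by rewrite /row_len /=; congr part; lia.
Qed.

(** The heights at which the down steps of the border of lam start, when a walk
  along the border starts at height k, a right step adds n and a down step
  subtracts m. *)
Definition heights lam k : set int :=
  [set z | exists a : 'I_n, z = k + n%:Z * (row_len lam a)%:Z - m%:Z * a%:Z].

(** The effect of [rho x] on heights: those in the residue class of [- m * x.2.1] modulo [n] move by
    [n] or [-n] according to the sign of [x]. No diagram or representative enters, which is why the
    action descends to classes. *)
Definition shift x (A : set int) : set int :=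
  [set z | if (n%:Z %| z + m%:Z * x.2.1%:Z)%Z then A (z - (-1) ^+ x.1 * n%:Z) else A z].

Hypotheses (n_gt0 : (0 < n)%N) (nm : coprime n m).

(** Row [a] of the new diagram matches row [a - 1] of [lam], and the added [m] makes up for the
    index. The new top row, at height [k + m], matches the full bottom row, at height
    [k + n * m - m * (n - 1)]. *)
Lemma heights_rdel lam k : young_rfull lam ->
  heights (young_rdel lam) (k + m%:Z) = heights lam k.
Proof.
move=> rf; apply/seteqP; split=> z [a ->]; have an := ltn_ord a.
- have [a0|a0] := eqVneq (a : nat) 0%N.
    have lt : (n.-1 < n)%N by rewrite ltn_predL.
    exists (Ordinal lt); rewrite (row_rfull rf) // row_rdel a0 /=; nia.
  have lt : (a.-1 < n)%N by lia.
  exists (Ordinal lt); rewrite row_rdel (negbTE a0) /row_len /= prednK ?lt0n //; nia.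
have [ea|na] := eqVneq (a : nat) n.-1.
  exists (Ordinal n_gt0); rewrite (row_rfull rf) // row_rdel /= ea; nia.
have lt : (a.+1 < n)%N by lia.
exists (Ordinal lt); rewrite row_rdel /row_len /=; nia.
Qed.

Lemma heights_cdel lam k : young_cfull lam ->
  heights (young_cdel lam) (k + n%:Z) = heights lam k.
Proof.
move=> cf; apply/seteqP; split=> z [a ->]; exists a; have := row_cfull a cf;
  rewrite row_cdel; nia.
Qed.

(** [m] is invertible modulo [n] and two row indices differ by less than [n]. The summand [e]
    absorbs all multiples of [n] that occur in heights. *)
Lemma dvd_ord (a c : 'I_n) (e : int) : (n%:Z %| e)%Z ->
  (n%:Z %| e + m%:Z * (a%:Z - c%:Z))%Z = (a == c).
Proof.
move=> ne; rewrite rpredDl // Gauss_dvdzr; last by rewrite coprimezE.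
apply/idP/eqP => [|->]; last by rewrite subrr dvdz0.
case/dvdzP=> q e'; apply/val_inj => /=; have an := ltn_ord a; have cn := ltn_ord c.
have q0 : q = 0 by nia.
by move: e'; rewrite q0 mul0r => /eqP; rewrite subr_eq0 => /eqP[].
Qed.

(** For fixed [k] the residue of a height modulo [n] names its row, and the height then gives the
    row length. *)
Lemma heights_inj lam mu k : heights lam k = heights mu k -> lam = mu.
Proof.
move=> e; apply: row_inj => a.
have [c ec] : heights mu k (k + n%:Z * (row_len lam a)%:Z - m%:Z * a%:Z).
  by rewrite -e; exists a.
have ca : c = a.
  have d0 : (n%:Z %| n%:Z * ((row_len mu c)%:Z - (row_len lam a)%:Z))%Z by rewrite dvdz_mulr.
  apply/esym/eqP; rewrite -(dvd_ord a c d0).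
  (* By [ec] the two expressions for the height agree, so the number to be divided is 0. *)
  by apply/dvdzP; exists 0; move: ec; nia.
by subst c; move: ec; nia.
Qed.

(** The down step of row a starts at a height congruent to k - m a modulo n, so
  the residue singles out the row moved by x after the rotation eta^i nu^j. *)
Lemma heights_move x i j lam : let k := i * n%:Z + j * m%:Z in
  youngR (etanu i j x) lam ->
  heights (young_move (etanu i j x) lam) k = shift x (heights lam k).
Proof.
move=> k xl; set y := etanu i j x in xl *.
have sgn : x.1 = y.1 by rewrite etanu_sign.
have dvd (c : 'I_n) (t : int) :
    (n%:Z %| k + n%:Z * t - m%:Z * c%:Z + m%:Z * x.2.1%:Z)%Z = (c == y.2.1).
  rewrite eq_sym -(@dvd_ord _ _ (n%:Z * (i + t) - m%:Z * (y.2.1%:Z - x.2.1%:Z - j))).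
    by congr (_ %| _)%Z; rewrite /k; ring.
  by rewrite rpredB ?(dvdz_mulr _ (dvdzz _)) // dvdz_mull // etanu_row.
apply/seteqP; split=> z.
  case=> a ->; rewrite /shift /= dvd row_move //.
  case: eqP => [_|_]; exists a => //; last by rewrite addr0.
  by rewrite sgn; move: ((-1) ^+ _) => e; ring.
rewrite /shift /=; case: ifP => [nz [a ez]|nz [a ez]].
  have ea : a == y.2.1.
    rewrite -(dvd a ((row_len lam a)%:Z + (-1) ^+ x.1)).
    by move: nz; congr (_ %| _)%Z; rewrite -[z](subrK ((-1) ^+ x.1 * n%:Z)) ez; ring.
  by exists a; rewrite row_move // ea -sgn -[z](subrK ((-1) ^+ x.1 * n%:Z)) ez; ring.
exists a; rewrite row_move //.
by move: nz; rewrite ez dvd => ->; rewrite addr0.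
Qed.

End Heights.

(** What a model has to share with the diagrams for the extension to be proved once for all three
    models. *)
Record young_iso n m (D : action_data n m) (g : young n m -> D) : Prop := YoungIso {
  iso_inj : injective g;
  iso_surj : forall x, exists lam, x = g lam;
  iso_rfull : forall lam, rfull (g lam) <-> young_rfull lam;
  iso_cfull : forall lam, cfull (g lam) <-> young_cfull lam;
  iso_rdel : forall lam, rdel (g lam) = g (young_rdel lam);
  iso_cdel : forall lam, cdel (g lam) = g (young_cdel lam);
  iso_dom : forall al lam, dom D al (g lam) <-> youngR al lam;
  iso_act : forall al (x : dom D al) lam,
    val x = g lam -> actr x = g (young_move al lam) }.

(** * Descent of the action to classes *)

Section Extension.
Variables n m : nat.
Hypotheses (n_gt0 : (0 < n)%N) (nm : coprime n m).
Variables (D : action_data n m) (g : young n m -> D).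
Hypothesis gD : young_iso g.
Implicit Types (lam mu : young n m) (al : isoroot n m) (i j k l : int).

Lemma equiv_heights (p q : D * int) : Defs.equiv p q -> forall lam mu,
  p.1 = g lam -> q.1 = g mu -> heights lam p.2 = heights mu q.2.
Proof.
elim=> {p q} [p q st|p|p q _ IH|p q r _ IHpq _ IHqr] lam mu.
- case: st => x k full /= ex; rewrite ex.
    rewrite (iso_rdel gD) => /(iso_inj gD) <-; rewrite heights_rdel //.
    by apply/(iso_rfull gD); rewrite -ex.
  rewrite (iso_cdel gD) => /(iso_inj gD) <-; rewrite heights_cdel //.
  by apply/(iso_cfull gD); rewrite -ex.
- by move=> -> /(iso_inj gD) ->.
- by move=> eq ep; rewrite (IH mu lam).
- by move=> ep er; have [ka eq] := iso_surj gD q.1; rewrite (IHpq lam ka) // (IHqr ka mu).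
Qed.

Lemma equiv_rdel lam k : young_rfull lam ->
  Defs.equiv (g lam, k) (g (young_rdel lam), k + m%:Z).
Proof.
move=> full; apply: Relation_Operators.rst_step; rewrite -(iso_rdel gD).
by constructor; apply/(iso_rfull gD).
Qed.

Lemma equiv_cdel lam k : young_cfull lam ->
  Defs.equiv (g lam, k) (g (young_cdel lam), k + n%:Z).
Proof.
move=> full; apply: Relation_Operators.rst_step; rewrite -(iso_cdel gD).
by constructor; apply/(iso_cfull gD).
Qed.

(** The border of lam can be rotated until it starts with its a-th down step:
  while the first letter is r (no empty row), remove the first column; while
  it is d, undo the removal of a full row. *)
Lemma equiv_row lam k (a : 'I_n) :
  exists mu, Defs.equiv (g lam, k) (g mu, k + n%:Z * (row_len lam a)%:Z - m%:Z * a%:Z).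
Proof.
(* Removing a column shortens row [a], and adding a full row at the bottom turns [a] into [a - 1];
   both lower this sum and keep the target height. *)
have [N] := ubnP (a + row_len lam a); elim: N lam k a => // N IH lam k a leN.
have [r0|r0] := posnP (row_len lam (Ordinal n_gt0)); last first.
  have pos c : (0 < row_len lam c)%N by apply: leq_trans r0 (row_le _ _).
  have pa := pos a; have [|mu emu] := IH (young_cdel lam) (k + n%:Z) a.
    by rewrite row_cdel; lia.
  exists mu; apply: Relation_Operators.rst_trans (equiv_cdel k (cfull_row pos)) _.
  by move: emu; rewrite row_cdel; congr (Defs.equiv _ (_, _)); nia.
have [a0|a0] := posnP a.
  exists lam; rewrite (_ : row_len lam a = 0%N) ?a0 ?mulr0 ?subr0 ?addr0.
    exact: Relation_Operators.rst_refl.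
  by rewrite -r0; congr row_len; apply: val_inj.
have an := ltn_ord a; have lt : (a.-1 < n)%N by lia.
have l0 : part lam n.-1 = 0%N by rewrite -r0 /row_len /= subn1.
have m0 : part (young_radd lam) 0 = m by rewrite part_radd.
have ra : row_len (young_radd lam) (Ordinal lt) = row_len lam a.
  rewrite /row_len part_radd /=; last by lia.
  by case e: (n - _)%N => [|p]; [lia|congr part; lia].
have := equiv_rdel (k - m%:Z) (lam := young_radd lam) m0; rewrite raddK // subrK => er.
have [|mu emu] := IH (young_radd lam) (k - m%:Z) (Ordinal lt).
  by rewrite ra /=; lia.
exists mu; apply: Relation_Operators.rst_trans (Relation_Operators.rst_sym _ _ _ _ er) _.
by move: emu; rewrite ra /=; congr (Defs.equiv _ (_, _)); nia.
Qed.

(** Conversely, both walks are rotated to start at a common height [z]; the diagrams reached have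
    the same heights at the same offset, so they coincide by [heights_inj]. *)
Lemma equivP lam mu k l :
  Defs.equiv (g lam, k) (g mu, l) <-> heights lam k = heights mu l.
Proof.
split=> [/equiv_heights/(_ lam mu)|e]; first exact.
pose a := Ordinal n_gt0; have [mu' emu] := equiv_row mu l a.
set z := l + _ - _ in emu; have [c ec] : heights lam k z by rewrite e; exists a.
have [lam' elam] := equiv_row lam k c; rewrite -ec in elam.
have := equiv_heights emu erefl erefl; rewrite -e (equiv_heights elam erefl erefl).
move=> /(heights_inj n_gt0 nm) e'; rewrite e' in elam.
exact: Relation_Operators.rst_trans elam (Relation_Operators.rst_sym _ _ _ _ emu).
Qed.

Lemma cls_eq (x y : D) k l : cls x k = cls y l <-> Defs.equiv (x, k) (y, l).
Proof.
split=> [/(congr1 val)/= e|e].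
  suff : [set q | Defs.equiv (y, l) q] (y, l) by rewrite -e.
  exact: Relation_Operators.rst_refl.
apply: val_inj; apply/seteqP; split=> q eq; apply: Relation_Operators.rst_trans eq => //.
exact: Relation_Operators.rst_sym.
Qed.

Lemma cls_gE lam mu k l :
  cls (g lam) k = cls (g mu) l <-> heights lam k = heights mu l.
Proof. by rewrite cls_eq equivP. Qed.

Local Notation at_ i j := (i * n%:Z + j * m%:Z).

Lemma classRP al (C : classes D) : classR D al C <->
  exists lam i j, youngR (etanu i j al) lam /\ C = cls (g lam) (at_ i j).
Proof.
split=> [[i [j [x [Cx]]]]|[lam [i [j [dlam ->]]]]].
  have [lam ex] := iso_surj gD x; rewrite ex => /(iso_dom gD) dlam.
  exists lam, i, j; split=> //; case: C Cx => C CP /= Cx.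
  have [[y l] eC] := set_mem CP; subst C; apply: val_inj.
  by rewrite -ex; have /= -> := congr1 val (proj2 (cls_eq y x l _) Cx).
exists i, j, (g lam); split; first exact: Relation_Operators.rst_refl.
exact/(iso_dom gD).
Qed.

(** The action as a relation, over all representatives and all [i], [j]; well-definedness becomes
    [moved_uniq]. *)
Definition moved al (C C' : classes D) : Prop := exists lam i j,
  [/\ youngR (etanu i j al) lam, C = cls (g lam) (at_ i j)
    & C' = cls (g (young_move (etanu i j al) lam)) (at_ i j)].

(** Every image has the heights [shift al] of the heights of [C], and heights determine the
    class. *)
Lemma moved_uniq al C C1 C2 : moved al C C1 -> moved al C C2 -> C1 = C2.
Proof.
move=> [lam [i [j [lamR -> ->]]]] [mu [i' [j' [muR e ->]]]].
by apply/cls_gE; move/cls_gE: e => e; rewrite !heights_move // e.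
Qed.

(** The default [C] is taken exactly outside [classR D al]. *)
Definition class_move al (C : classes D) : classes D :=
  if pselect (exists C', moved al C C') is left h then projT1 (cid h) else C.

Lemma class_moveE al C C' : moved al C C' -> class_move al C = C'.
Proof.
rewrite /class_move => CC'; case: pselect => [h|[]]; last by exists C'.
exact: moved_uniq (projT2 (cid h)) CC'.
Qed.

Lemma class_move_cls al i j lam : youngR (etanu i j al) lam ->
  class_move al (cls (g lam) (at_ i j)) =
  cls (g (young_move (etanu i j al) lam)) (at_ i j).
Proof. by move=> lamR; apply: class_moveE; exists lam, i, j. Qed.

Lemma class_move_in al C : classR D al C -> classR D (neg al) (class_move al C).
Proof.
move=> /classRP[lam [i [j [lamR ->]]]]; rewrite class_move_cls //; apply/classRP.
by exists (young_move (etanu i j al) lam), i, j; rewrite etanu_neg; split=> //;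
  exact: young_move_in.
Qed.

Lemma class_moveK al C :
  classR D al C -> class_move (neg al) (class_move al C) = C.
Proof.
move=> /classRP[lam [i [j [lamR ->]]]]; rewrite !class_move_cls ?etanu_neg //.
  by rewrite young_moveK.
exact: young_move_in.
Qed.

Lemma action_extends :
  exists HH : functor (Tiso n m) (subset_groupoid (classes D)),
    [/\ forall al, HH al = classR D al,
        forall al i j (x : dom D (etanu i j al)),
          maps (fmap HH (rho al)) (cls (val x) (at_ i j)) (cls (actr x) (at_ i j)),
        injective (fun x : D => cls x 0)
      & forall al (x : dom D al),
          maps (fmap HH (rho al)) (cls (val x) 0) (cls (actr x) 0)].
Proof.
exists (make_functor class_move_in class_moveK).
have mapsE al i j (x : dom D (etanu i j al)) :
    maps (fmap (make_functor class_move_in class_moveK) (rho al))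
      (cls (val x) (at_ i j)) (cls (actr x) (at_ i j)).
  have [lam ex] := iso_surj gD (val x); rewrite (iso_act gD ex) ex.
  have lamR : youngR (etanu i j al) lam.
    by apply/(iso_dom gD); rewrite -ex; exact: set_mem (valP x).
  have Cin : cls (g lam) (at_ i j) \in classR D al.
    by apply/mem_set/classRP; exists lam, i, j.
  by exists (exist (fun C => C \in classR D al) _ Cin) => //; exact: class_move_cls.
split=> //.
- move=> x y; have [lam ->] := iso_surj gD x; have [mu ->] := iso_surj gD y.
  by move=> /cls_gE/(heights_inj n_gt0 nm) ->.
(* [etanu 0 0 al] reduces to [al]. *)
- by move=> al x; have := mapsE al 0 0 x; rewrite !mul0r addr0.
Qed.

End Extension.

(** * Diagrams as inversion sets of shuffles *)

Section Inversions.
Variables n m : nat.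
Local Notation idx := (idx n m).
Implicit Types (lam mu : young n m) (w : word n m) (x : isoroot n m) (s : seq idx).

(** Inversions relative to the shuffle [epss ++ deltas], which belongs to the empty diagram. *)
Definition inversions s : {set 'I_n * 'I_m} :=
  [set b | (index (inr b.2 : idx) s < index (inl b.1 : idx) s)%N]%SET.

Lemma index_total s (a c : idx) : is_shuffle s ->
  (index a s <= index c s)%N = (a == c) || (index a s < index c s)%N.
Proof.
move=> ss; rewrite leq_eqVlt; congr (_ || _).
by apply/eqP/eqP => [/(index_inj a (mem_shuffle a ss) (mem_shuffle c ss))|->].
Qed.

(** Entries of the same kind have the same order in every shuffle, and a mixed pair is one box. The
    hypothesis is local because it is also applied to inversion sets that differ in a box. *)
Lemma eq_index_le s t (a c : idx) : is_shuffle s -> is_shuffle t ->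
  (forall b, (inr b.2 \in [:: a; c]) && (inl b.1 \in [:: a; c]) ->
    (b \in inversions s) = (b \in inversions t)) ->
  (index a s <= index c s)%N = (index a t <= index c t)%N.
Proof.
move=> ss st; case: a c => [i|j] [k|l] e.
- by rewrite !shuffle_even.
- have := e (i, l); rewrite !inE !eqxx ?orbT => /(_ isT) /=.
  by rewrite ![in X in X -> _]ltnNge => /negb_inj.
- have := e (k, j); rewrite !inE !eqxx ?orbT => /(_ isT) /=.
  by rewrite !index_total.
- by rewrite !shuffle_even.
Qed.

Lemma inversions_inj s t : is_shuffle s -> is_shuffle t ->
  inversions s = inversions t -> s = t.
Proof.
(* A Borel subalgebra records just the order of the entries, so its injectivity is reused, with
   [rat] as an arbitrary field. *)
move=> ss st e; apply: (@shuffle_borel_inj rat) => //.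
by apply: eq_unit_span => a c; apply: eq_index_le => // b _; rewrite e.
Qed.

Lemma sh_inversions_inj v w : inversions (sh v) = inversions (sh w) -> v = w.
Proof. by move=> /(inversions_inj (sh_shuffle v) (sh_shuffle w)) /sh_inj. Qed.

(** The prefix [w1] stops right before the entry [i], and its letters r are filled by the first
    entries of [deltas]. *)
Lemma sh_before w (w1 w2 : seq bool) (i : 'I_n) (j : 'I_m) : val w = w1 ++ true :: w2 ->
  count_mem true w1 = i ->
  ((i, j) \in inversions (sh w)) = (j < count_mem false w1)%N.
Proof.
move=> ew ci; have [fe fd me] := sh_filters w; have us := shuffle_uniq (sh_shuffle w).
rewrite inE /=; move: (sh w) fe fd me us => s fe fd; rewrite ew => me us.
pose s1 := take (size w1) s.
have es : s = s1 ++ drop (size w1) s by rewrite cat_take_drop.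
have m1 : map is_eps s1 = w1 by rewrite map_take me take_size_cat.
case es2 : (drop (size w1) s) es => [|z s2] es.
  by have := congr1 (drop (size w1)) me; rewrite -map_drop es2 drop_size_cat.
have ze : is_eps z.
  by have := congr1 (drop (size w1)) me; rewrite -map_drop es2 drop_size_cat //= => -[].
have sz : size (filter is_eps s1) = i.
  by rewrite size_filter -ci -m1 count_map; apply: eq_count => y /=; rewrite eqb_id.
have zi : z = inl i.
  have := congr1 (nth z ^~ i) fe; rewrite es filter_cat /= ze nth_cat sz ltnn subnn /=.
  by rewrite (nth_map i) ?size_enum_ord // nth_ord_enum.
have ii : index (inl i : idx) s = size s1.
  move: us; rewrite es zi index_cat cat_uniq /= => /and3P[_ /norP[/negbTE -> _] _].
  by rewrite eqxx addn0.
have d1 : filter (predC is_eps) s1 = take (count_mem false w1) (deltas n m).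
  rewrite -fd es filter_cat take_size_cat // size_filter -m1 count_map.
  by apply: eq_count => y /=; case: (is_eps y).
have -> : (index (inr j : idx) s < index (inl i : idx) s)%N = (inr j \in s1).
  by rewrite ii [in LHS]es index_cat; case: ifP => [|_]; rewrite ?index_mem // ltnNge leq_addr.
have -> : (inr j \in s1) = (inr j \in filter (predC is_eps) s1) by rewrite mem_filter.
rewrite d1 in_take; last by rewrite map_f ?mem_enum.
by rewrite (index_map inr_inj) index_enum_ord.
Qed.

(** The prefix consists of the blocks of the rows above [i] and the right steps of block [i]; the
    numbers of right steps telescope. *)
Lemma border_before lam (i : 'I_n) : exists w1 w2 : seq bool,
  [/\ border lam = w1 ++ true :: w2, count_mem true w1 = i
    & count_mem false w1 = row_len lam i].
Proof.
pose blk k := rcons (nseq (border_row lam k.+1 - border_row lam k) false) true.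
pose pre k := flatten [seq blk j | j <- iota 0 k].
have preS k : pre k.+1 = pre k ++ blk k.
  by rewrite /pre -addn1 iotaD map_cat flatten_cat /= cats0.
have [preT preF] : (forall k, k <= n -> count_mem true (pre k) = k)%N /\
    (forall k, k <= n -> count_mem false (pre k) = border_row lam k)%N.
  split; elim=> [|k IH] kn //.
  - by rewrite preS count_cat IH ?(ltnW kn) // /blk -cats1 count_cat count_nseq /= addn1.
  - by rewrite /= /border_row subn0 part_over.
  - rewrite preS count_cat IH ?(ltnW kn) // /blk -cats1 count_cat count_nseq /= mul1n !addn0.
    by rewrite subnKC //; apply: part_le; rewrite leq_sub2l.
pose r := nseq (border_row lam i.+1 - border_row lam i) false.
have en : n = (i.+1 + (n - i.+1))%N by rewrite subnKC.
exists (pre i ++ r), (flatten [seq blk j | j <- iota i.+1 (n - i.+1)] ++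
  nseq (m - border_row lam n) false); split.
- rewrite /border -/blk [in iota 0 n]en iotaD map_cat flatten_cat -/(pre i.+1) preS.
  by rewrite /blk -/r -cats1 -!catA.
- by rewrite count_cat preT ?(ltnW (ltn_ord i)) // count_nseq /= addn0.
- rewrite count_cat preF ?(ltnW (ltn_ord i)) // count_nseq /= mul1n subnKC //.
  by apply: part_le; rewrite leq_sub2l.
Qed.

Lemma boxes_inversions lam : boxes lam = inversions (sh (word_of lam)).
Proof.
apply/setP => -[i j]; have [w1 [w2 [ew ci cj]]] := border_before lam i.
by rewrite in_boxes (@sh_before (word_of lam) w1 w2) // cj.
Qed.

Lemma word_of_inj : injective (@word_of n m).
Proof. by move=> lam mu e; apply: boxes_inj; rewrite !boxes_inversions e. Qed.

(** The preimage has as row lengths the numbers of inversions in each row. Shuffles keep the order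
    of rows and columns, so the sets [B i] grow with [i] and are initial segments. *)
Lemma word_of_surj w : exists lam, w = word_of lam.
Proof.
have ss := sh_shuffle w; pose B i := [set j | (i, j) \in inversions (sh w)]%SET.
pose f p := if insub p is Some q then #|B (rev_ord q)| else 0%N.
have fle p q : (p <= q)%N -> (f q <= f p)%N.
  rewrite /f; case: insubP => // q' qn eq' pq.
  rewrite insubT ?(leq_ltn_trans pq) //= => pn.
  apply/subset_leq_card/fintype.subsetP => j; rewrite !inE /= => lt.
  apply: leq_trans lt _; rewrite shuffle_even //= leq_sub2l // ltnS.
  by rewrite eq'.
exists (young_of n m fle); apply: sh_inversions_inj; rewrite -boxes_inversions.
apply/setP => -[i j]; rewrite in_boxes /row_len part_young_of ?ltn_ord //; last first.
  by rewrite /f; case: insubP => // q _ _; rewrite -[leqRHS]card_ord max_card.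
have lt : (n - i.+1 < n)%N by have := ltn_ord i; lia.
rewrite /f /= (insubT (fun p => p < n)%N lt) /=.
have -> : rev_ord (Sub (n - i.+1)%N lt) = i.
  by rewrite -[RHS]rev_ordK; congr rev_ord; apply: val_inj.
rewrite down_closed_card ?inE // => p q pq; rewrite !inE /=; apply: leq_ltn_trans.
by rewrite shuffle_even //= leq_add2l.
Qed.

(** Every entry other than [p] and [q] keeps its position, which lies before or after both of
    theirs. *)
Lemma index_swap s1 s2 (p q a c : idx) : uniq (s1 ++ p :: q :: s2) ->
  ~~ ((a \in [:: p; q]) && (c \in [:: p; q])) ->
  (index a (s1 ++ p :: q :: s2) < index c (s1 ++ p :: q :: s2))%N =
  (index a (s1 ++ q :: p :: s2) < index c (s1 ++ q :: p :: s2))%N.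
Proof.
move=> us; have us' : uniq (s1 ++ q :: p :: s2).
  by move: us; rewrite !(uniq_catC s1) /= !inE !negb_or (eq_sym q p) => /and3P[
    /andP[-> ->] -> ->].
have [ip iq] := index_adjacent us; have [iq' ip'] := index_adjacent us'.
have other y : y \notin [:: p; q] ->
    index y (s1 ++ p :: q :: s2) = index y (s1 ++ q :: p :: s2) /\
    ((index y (s1 ++ q :: p :: s2) < size s1)%N \/
     ((size s1).+1 < index y (s1 ++ q :: p :: s2))%N).
  rewrite !inE negb_or => /andP[/negbTE yp /negbTE yq].
  rewrite !index_cat; case: ifP => [ys|_]; first by rewrite index_mem ys; split; [|left].
  rewrite /= !(eq_sym _ y) yp yq; split; first by [].
  by right; rewrite !addnS !ltnS leq_addr.
have [a_in|/other[-> oa]] := boolP (a \in [:: p; q]);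
  have [c_in|/other[-> oc]] := boolP (c \in [:: p; q]) => // _.
  by move: a_in; rewrite !inE => /orP[]/eqP->; rewrite ?ip ?iq ?ip' ?iq'; lia.
by move: c_in; rewrite !inE => /orP[]/eqP->; rewrite ?ip ?iq ?ip' ?iq'; lia.
Qed.

(** Treats both signs of [x] at once: the box condition of [youngR] says that [src x] precedes
    [tgt x]. *)
Lemma inversion_ends s x : is_shuffle s ->
  ((x.2 \in inversions s) == x.1) = (index (src x) s < index (tgt x) s)%N.
Proof.
move=> ss; case: x => -[] [i j]; rewrite inE /=; first by case: ltnP.
rewrite [RHS]ltnNge index_total //=; by case: ltnP.
Qed.

Lemma in_toggle x (B : {set 'I_n * 'I_m}) b : b != x.2 ->
  (b \in toggle x B) = (b \in B).
Proof. by move=> /negbTE bx; rewrite /toggle; case: (x.1); rewrite !inE bx. Qed.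

Lemma toggle_end x (B : {set 'I_n * 'I_m}) : (x.2 \in toggle x B) = ~~ x.1.
Proof. by rewrite /toggle; case: (x.1); rewrite ?setD11 ?setU11. Qed.

Lemma inversions_swap x s1 s2 : let s := s1 ++ src x :: tgt x :: s2 in
  is_shuffle s ->
  inversions (s1 ++ tgt x :: src x :: s2) = toggle x (inversions s).
Proof.
move=> s ss; have us := shuffle_uniq ss; have ss' := shuffle_swap (src_tgt x) ss.
have [i_s i_t] := index_adjacent us; have [i_t' i_s'] := index_adjacent (shuffle_uniq ss').
apply/setP => b; have [->|bx] := eqVneq b x.2.
  have := inversion_ends (neg x) ss'; rewrite srcN tgtN i_t' i_s' ltnSn.
  by move=> /eqP /= ->; rewrite toggle_end.
have e : (b \in inversions (s1 ++ tgt x :: src x :: s2)) = (b \in inversions s).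
  rewrite !inE -index_swap //; apply: contra bx => /andP[].
  case: x b {s ss us ss' i_s i_t i_s' i_t'} => -[] [i j] [k l]; rewrite !inE /= ?orbF.
    by move=> /eqP[->] /eqP[->].
  by move=> /eqP[->] /eqP[->].
by rewrite e in_toggle.
Qed.

(** Swapping adjacent [src x] and [tgt x] toggles the box. Conversely, a toggled diagram gives a
    shuffle [t] in which only the order of this pair differs from [s], which forces adjacency. *)
Lemma word_of_dom x lam : wordR x (word_of lam) <-> youngR x lam.
Proof.
have ss := sh_shuffle (word_of lam); rewrite /youngR /= boxes_inversions.
split=> [xw|[xl [mu emu]]].
  have [s1 [s2 es]] := root_shuffle (shuffle_uniq ss) xw; rewrite es in ss *.
  split.
    apply/eqP; rewrite inversion_ends //.
    by have [-> ->] := index_adjacent (shuffle_uniq ss).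
  have [mu emu] := word_of_surj (word_move x (word_of lam)).
  by exists mu; rewrite boxes_inversions -emu (sh_move es) inversions_swap.
set s := sh (word_of lam) in ss xl emu.
have st := sh_shuffle (word_of mu); rewrite boxes_inversions in emu.
set t := sh (word_of mu) in st emu.
have lt_s : (index (src x) s < index (tgt x) s)%N by rewrite -inversion_ends // xl.
have lt_t : (index (tgt x) t < index (src x) t)%N.
  rewrite ltnNge index_total // negb_or src_neq_tgt -inversion_ends // emu toggle_end.
  by case: (x.1).
have lt_is : ((index (src x) s).+1 < size s)%N.
  by apply: leq_ltn_trans lt_s _; rewrite index_mem mem_shuffle.
(* Were the successor z of src x in s not tgt x, the order src x, z, tgt x would
   persist in t, where tgt x precedes src x. *)
pose z := nth (src x) s (index (src x) s).+1.
have iz : index z s = (index (src x) s).+1 by rewrite index_uniq ?shuffle_uniq.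
have zx : z != src x by apply: contra_eqN iz => /eqP->; rewrite ltn_eqF.
have [zt|zt] := eqVneq z (tgt x).
  apply/shuffle_rootsP; exists (src x), (tgt x), (take (index (src x) s) s),
    (drop (index (src x) s).+2 s); split=> //.
  by rewrite -zt -{2}(nth_index (src x) (mem_shuffle (src x) ss)) -split_adjacent.
have keep (a c : idx) : ~~ ((src x \in [:: a; c]) && (tgt x \in [:: a; c])) ->
    (index a s <= index c s)%N = (index a t <= index c t)%N.
  move=> nac; apply: eq_index_le => // b bac; rewrite emu in_toggle //.
  apply: contra nac => /eqP eb; move: bac; rewrite eb /src /tgt.
  by case: (x.1) => // /andP[-> ->].
move: lt_t; rewrite ltnNge => /negP[]; apply: (@leq_trans (index z t)).
  rewrite -keep ?iz // !inE eqxx /= negb_or (eq_sym _ z) zt.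
  by rewrite eq_sym src_neq_tgt.
rewrite -keep ?iz // !inE eqxx orbT andbT (eq_sym _ z) negb_or zx.
by rewrite src_neq_tgt.
Qed.

Lemma word_of_move x lam : youngR x lam ->
  word_move x (word_of lam) = word_of (young_move x lam).
Proof.
move=> xl; have xw := proj2 (word_of_dom x lam) xl; have ss := sh_shuffle (word_of lam).
have [s1 [s2 es]] := root_shuffle (shuffle_uniq ss) xw.
apply: sh_inversions_inj; rewrite -boxes_inversions (boxes_move xl) boxes_inversions.
by rewrite (sh_move es) es inversions_swap // -es.
Qed.

End Inversions.

(** * The three models as copies of the diagrams *)

Lemma young_young_iso n m : young_iso (D := young_action n m) id.
Proof. by split=> // [x|al x lam <-] //; exists x. Qed.

Section Transport.
Variables (n m : nat) (Y : Type) (g : young n m -> Y).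
Variable H : functor (Tiso n m) (subset_groupoid Y).
Hypotheses (g_inj : injective g) (g_surj : forall y, exists lam, y = g lam).

Lemma ginvK : cancel g (ginv g).
Proof. by move=> lam; apply: xget_unique => // mu /g_inj. Qed.

(** Full sets and deletions agree by construction, so only the action has to be compared. *)
Lemma transported_iso :
  (forall al lam, dom (transported g H) al (g lam) <-> youngR al lam) ->
  (forall al (x : dom (transported g H) al) lam, val x = g lam ->
    actr x = g (young_move al lam)) ->
  young_iso (D := transported g H) g.
Proof.
move=> domE actE; split=> //= lam; rewrite ?ginvK //.
  by split=> [[mu mufull /g_inj <-]|full] //; exists lam.
by split=> [[mu mufull /g_inj <-]|full] //; exists lam.
Qed.

End Transport.

Lemma word_young_iso n m : young_iso (D := word_action n m) (@word_of n m).
Proof.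
apply: transported_iso; [exact: word_of_inj|exact: word_of_surj|exact: word_of_dom|].
move=> al x lam ex; have xR : wordR al (val x) := set_mem (valP x).
rewrite -word_of_move -?ex //; apply/word_of_dom; by rewrite -ex.
Qed.

(** Simple roots are differences of consecutive entries of the shuffle, so the odd reflection swaps
    two adjacent entries, as the move on words does. *)
Lemma borel_young_iso (K : fieldType) n m :
  young_iso (D := borel_action n m K) (fun lam => borel_of K (word_of lam)).
Proof.
have domE al (lam : young n m) :
    borelR al (borel_of K (word_of lam)) <-> youngR al lam.
  by rewrite -word_of_dom; exact: simple_shuffle (sh_shuffle _).
apply: transported_iso.
- move=> lam mu /(congr1 val) /(shuffle_borel_inj (sh_shuffle _) (sh_shuffle _)).
  by move=> /sh_inj/word_of_inj.
- move=> b; have [s ss eb] := borel_shuffle b.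
  have [lam elam] := word_of_surj (exist (is_word n m) _ (shuffle_word ss)).
  by exists lam; apply: val_inj; rewrite /= -elam shuffle_sh.
- exact: domE.
move=> al x lam ex; have xR : borelR al (val x) := set_mem (valP x).
rewrite ex in xR; have /domE yR := xR.
have [s1 [s2 es]] := root_shuffle (shuffle_uniq (sh_shuffle _)) (proj2 (word_of_dom al lam) yR).
rewrite -word_of_move //; apply: val_inj; rewrite /= (sh_move es).
by apply: borel_moveE; rewrite -es ?ex //; exact: sh_shuffle.
Qed.

Lemma model_young_iso (K : fieldType) n m M :
  exists g : young n m -> model_action K n m M, young_iso g.
Proof.
case: M; eexists; [exact: young_young_iso|exact: word_young_iso|].
exact: borel_young_iso.
Qed.

Theorem theorem3p4 (K : fieldType) (n m : nat) (n_gt0 : (0 < n)%N)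
  (m_gt0 : (0 < m)%N) (nm : coprime n m) (M : model)
  (D := model_action K n m M)
  (cond_r : forall (be : isoroot n m) (x : dom D be) (y : dom D (nu_root be)),
     positive be -> rfull (val x) -> val y = rdel (val x) ->
     rfull (actr x) /\ rdel (actr x) = actr y)
  (cond_c : forall (be : isoroot n m) (x : dom D be) (y : dom D (eta_root be)),
     positive be -> cfull (val x) -> val y = cdel (val x) ->
     cfull (actr x) /\ cdel (actr x) = actr y) :
  exists HH : functor (Tiso n m) (subset_groupoid (classes D)),
    [/\ forall al : isoroot n m, HH al = classR D al,
        forall (al : isoroot n m) (i j : int) (x : dom D (etanu i j al)),
          maps (fmap HH (rho al))
            (cls (val x) (i * n%:Z + j * m%:Z))
            (cls (actr x) (i * n%:Z + j * m%:Z)),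
        injective (fun x : D => cls x 0)
      & forall (al : isoroot n m) (x : dom D al),
          maps (fmap HH (rho al)) (cls (val x) 0) (cls (actr x) 0)].
Proof.
have [g /(action_extends n_gt0 nm)] := model_young_iso K n m M; exact.
Qed.
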